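(* Let $(M,H)$ be an $n$-dimensional Carnot manifold with weight sequence $(w_1,\ldots,w_n)$, let $(X_1,\ldots,X_n)$ be an $H$-frame near a point $a\in M$, and let $(x_1,\ldots,x_n)$ be local coordinates centered at $a$ that are linearly adapted to the $H$-frame $(X_1,\ldots,X_n)$. Then there is a unique change of coordinates $x\mapsto\hat\psi(x)$ such that: (1) It provides us with privileged coordinates at $a$ adapted to $(X_1,\ldots,X_n)$. (2) For $k=1,\ldots,n$, the $k$-th component $\hat\psi_k(x)$ is of the form $$\hat\psi_k(x)=x_k+\sum_{\substack{\langle\alpha\rangle<w_k\\|\alpha|\ge2}}a_{k\alpha}x^\alpha,\qquad a_{k\alpha}\in\mathbb{R}.$$
   Context: A Carnot manifold of step $r$ is a pair $(M,H)$, where $M$ is a smooth manifold and $H=(H_1,\ldots,H_r)$ is a filtration of subbundles $H_1\subset\cdots\subset H_r=TM$ such that Lie brackets of sections of $H_w$ and $H_{w'}$ are sections of $H_{w+w'}$ whenever $w+w'\le r$. With $n=\dim M$, its weight sequence is $w_j=\min\{w\in\{1,\ldots,r\}:\ j\le\operatorname{rk}H_w\}$, $j=1,\ldots,n$. An $H$-frame over an open set is a tangent frame $(X_1,\ldots,X_n)$ such that each $X_j$ is a section of $H_{w_j}$. For a finite sequence $I=(i_1,\ldots,i_k)$ in $\{1,\ldots,n\}$ set $X_I=X_{i_1}\cdots X_{i_k}$ and $\langle I\rangle=w_{i_1}+\cdots+w_{i_k}$. A smooth function $f$ near $a$ has order $\ge N$ at $a$ ($N$ a non-negative integer) if $X_If(a)=0$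 whenever $\langle I\rangle<N$; it has order $N$ if moreover $X_If(a)\neq0$ for some $I$ with $\langle I\rangle=N$. Local coordinates centered at $a$ are linearly adapted at $a$ to $(X_1,\ldots,X_n)$ if, in these coordinates, $X_j(0)=\partial_j$ for $j=1,\ldots,n$. They are privileged coordinates at $a$ adapted to $(X_1,\ldots,X_n)$ if they are linearly adapted and, for every $k$, the coordinate function $x_k$ has order $w_k$ at $a$. For $\alpha\in\mathbb{N}_0^n$: $|\alpha|=\alpha_1+\cdots+\alpha_n$ and $\langle\alpha\rangle=w_1\alpha_1+\cdots+w_n\alpha_n$. *)

(* Defs.v *)
From mathcomp Require Export all_boot all_order all_algebra.
From mathcomp Require Export all_classical all_reals all_analysis.
Export numFieldNormedType.Exports.

Set Implicit Arguments.
Unset Strict Implicit.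
Unset Printing Implicit Defensive.

Import Order.TTheory GRing.Theory Num.Theory.

Local Open Scope classical_set_scope.
Local Open Scope ring_scope.

Section EuclideanSmoothness.
Context {R : realType} {n : nat}.
Implicit Types (f : 'rV[R]_n -> R) (V : set 'rV[R]_n).

Definition partial (i : 'I_n) f : 'rV[R]_n -> R := fun x => 'D_('e_i) f x.

(* Only meaningful for V open: the values of f off V are then irrelevant. *)
Fixpoint is_Ck (k : nat) V f : Prop :=
  (forall x, V x -> {for x, continuous f}) /\
  match k with
  | 0 => True
  | k'.+1 => forall i : 'I_n,
      (forall x, V x -> derivable f x 'e_i) /\ is_Ck k' V (partial i f)
  end.

Definition is_Cinfty V f := forall k, is_Ck k V f.

End EuclideanSmoothness.

(* A homeomorphism from an open subset [cdom] of M onto an open subset [cimg]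
   of R^n; [cmap] and [cinv] are total functions with irrelevant values outside
   [cdom] and [cimg]. *)
Record chart (R : realType) (n : nat) (M : topologicalType) := Chart {
  cdom : set M ;
  cimg : set 'rV[R]_n ;
  cmap :> M -> 'rV[R]_n ;
  cinv : 'rV[R]_n -> M ;
  cdom_open : open cdom ;
  cimg_open : open cimg ;
  cmap_img : forall p, cdom p -> cimg (cmap p) ;
  cinv_dom : forall x, cimg x -> cdom (cinv x) ;
  cmapK : forall p, cdom p -> cinv (cmap p) = p ;
  cinvK : forall x, cimg x -> cmap (cinv x) = x ;
  cmap_continuous : forall p, cdom p -> {for p, continuous cmap} ;
  cinv_continuous : forall x, cimg x -> {for x, continuous cinv}
}.

Definition smooth_transition (R : realType) (n : nat) (M : topologicalType)
    (c c' : chart R n M) :=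
  forall k : 'I_n,
    is_Cinfty (cimg c `&` cinv c @^-1` cdom c') (fun x => c' (cinv c x) 0 k).

Record manifold (R : realType) (n : nat) := Manifold {
  space :> topologicalType ;
  atlas : set (chart R n space) ;
  space_hausdorff : hausdorff_space space ;
  space_second_countable : @second_countable space ;
  atlas_cover : forall p : space, exists2 c, atlas c & cdom c p ;
  atlas_compatible : forall c c', atlas c -> atlas c' -> smooth_transition c c' ;
  atlas_maximal : forall c,
    (forall c', atlas c' -> smooth_transition c c' /\ smooth_transition c' c) ->
    atlas c
}.

Section VectorFields.
Context {R : realType} {n : nat} {M : manifold R n}.

Definition smooth_on (U : set M) (f : M -> R) :=
  forall c, atlas c -> is_Cinfty (cimg c `&` cinv c @^-1` U) (f \o cinv c).

Definition smooth_at (p : M) (f : M -> R) :=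
  exists U : set M, [/\ open U, U p & smooth_on U f].

(* Tangent vectors at p are represented as functionals acting on functions that
   are smooth near p; their values on other functions are irrelevant, so that
   they are compared with [tv_eq] rather than with Leibniz equality. *)
Definition functional := (M -> R) -> R.

Definition tv_eq (p : M) (v v' : functional) :=
  forall f, smooth_at p f -> v f = v' f.

Definition coord_vector (c : chart R n M) (p : M) (i : 'I_n) : functional :=
  fun f => partial i (f \o cinv c) (c p).

Definition lin_comb d (u : 'rV[R]_d) (Y : 'I_d -> functional) : functional :=
  fun f => \sum_(j < d) u 0 j * Y j f.

Definition tangent (p : M) (v : functional) :=
  exists c, [/\ atlas c, cdom c p &
    exists u : 'rV[R]_n, tv_eq p v (lin_comb u (coord_vector c p))].

Definition field_on := M -> functional.

Definition act (X : field_on) (f : M -> R) : M -> R := fun p => X p f.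

Definition vector_field (U : set M) (X : field_on) :=
  (forall p, U p -> tangent p (X p)) /\
  (forall V f, open V -> V `<=` U -> smooth_on V f -> smooth_on V (act X f)).

Definition lie_bracket (X Y : field_on) : field_on :=
  fun p f => act X (act Y f) p - act Y (act X f) p.

Definition basis_at (p : M) d (Y : 'I_d -> functional) (E : set functional) :=
  (forall u : 'rV[R]_d, tv_eq p (lin_comb u Y) (fun=> 0) -> u = 0) /\
  (forall v, E v <-> exists u : 'rV[R]_d, tv_eq p v (lin_comb u Y)).

Definition local_frame (U : set M) d (Y : 'I_d -> field_on)
    (E : M -> set functional) :=
  (forall j, vector_field U (Y j)) /\
  (forall p, U p -> basis_at p (fun j => Y j p) (E p)).

Definition subbundle (d : nat) (E : M -> set functional) :=
  forall p : M, exists U : set M, exists Y : 'I_d -> field_on,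
    [/\ open U, U p & local_frame U Y E].

Definition section (U : set M) (E : M -> set functional) (X : field_on) :=
  vector_field U X /\ forall p, U p -> E p (X p).

End VectorFields.

Arguments functional {R n} M.
Arguments field_on {R n} M.

(* Only [hbundle w] and [hrank w] with 1 <= w <= r are relevant. *)
Record carnot_manifold (R : realType) (n r : nat) := CarnotManifold {
  carnot_carrier :> manifold R n ;
  hbundle : nat -> carnot_carrier -> set (functional carnot_carrier) ;
  hrank : nat -> nat ;
  step_gt0 : (0 < r)%N ;
  hbundle_subbundle : forall w, (1 <= w <= r)%N ->
    subbundle (hrank w) (hbundle w) ;
  hbundle_incl : forall w p, (1 <= w < r)%N ->
    hbundle w p `<=` hbundle w.+1 p ;
  hbundle_top : forall p, hbundle r p = tangent p ;
  hbundle_bracket : forall w w' (U : set carnot_carrier) X Y,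
    (1 <= w)%N -> (1 <= w')%N -> (w + w' <= r)%N -> open U ->
    section U (hbundle w) X -> section U (hbundle w') Y ->
    section U (hbundle (w + w')) (lie_bracket X Y)
}.

Section CarnotManifolds.
Context {R : realType} {n r : nat} (M : carnot_manifold R n r).

(* The ordinal j stands for the index j + 1, whence the strict inequality; the
   minimum is over a nonempty set since hrank r = n (for M nonempty), so that
   the default value r of the big operator is harmless. *)
Definition weight (j : 'I_n) : nat :=
  \big[minn/r]_(1 <= w < r.+1 | (j < hrank M w)%N) w.

Definition H_frame (U : set M) (X : 'I_n -> field_on M) :=
  local_frame U X tangent /\
  forall j, section U (hbundle (weight j)) (X j).

Definition iter_act (X : 'I_n -> field_on M) (I : seq 'I_n) (f : M -> R) :
  M -> R := foldr (fun i => act (X i)) f I.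

Definition seq_weight (I : seq 'I_n) : nat := (\sum_(i <- I) weight i)%N.

Definition order_ge (X : 'I_n -> field_on M) (a : M) (f : M -> R) (N : nat) :=
  forall I, (seq_weight I < N)%N -> iter_act X I f a = 0.

Definition has_order (X : 'I_n -> field_on M) (a : M) (f : M -> R) (N : nat) :=
  order_ge X a f N /\
  exists I, seq_weight I = N /\ iter_act X I f a <> 0.

Definition centered_coords (a : M) (c : chart R n M) :=
  [/\ atlas c, cdom c a & c a = 0].

Definition linearly_adapted (X : 'I_n -> field_on M) (a : M)
    (c : chart R n M) :=
  centered_coords a c /\ forall j, tv_eq a (X j a) (coord_vector c a j).

Definition privileged (X : 'I_n -> field_on M) (a : M) (c : chart R n M) :=
  linearly_adapted X a c /\
  forall k, has_order X a (fun p => c p 0 k) (weight k).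

(* Multi-indices are only summed under the condition <alpha> < w_k <= r, which
   forces all their entries to be < r. *)
Definition multi_index := {ffun 'I_n -> 'I_r}.

Definition mi_length (alpha : multi_index) : nat := (\sum_i alpha i)%N.

Definition mi_weight (alpha : multi_index) : nat :=
  (\sum_i weight i * alpha i)%N.

Definition monomial (x : 'rV[R]_n) (alpha : multi_index) : R :=
  \prod_i x 0 i ^+ alpha i.

(* c' is the coordinate system psi o c on some neighbourhood cdom c'. *)
Definition changes_coords (psi : 'rV[R]_n -> 'rV[R]_n) (c c' : chart R n M) :=
  cdom c' `<=` cdom c /\ forall p, cdom c' p -> c' p = psi (c p).

End CarnotManifolds.

(* Main.v *)
Require Import Defs.
From mathcomp Require Import ring.

(** Fix the ordered words I_alpha = 1^alpha_1 ... n^alpha_n.  Applied at a, the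
    operator X_{I_alpha} kills x^beta when |beta| > |alpha|, and for
    |beta| = |alpha| it gives alpha! if beta = alpha and 0 otherwise, because
    x_i vanishes at a and X_i(x_j)(a) = delta_ij.  Hence the conditions
    X_{I_alpha}(psi_k)(a) = 0, for |alpha| >= 2 and <alpha> < w_k, form a linear
    system in the a_{k alpha} that is triangular with respect to |alpha|: it has
    exactly one solution, which gives uniqueness.  For existence, every word I
    with <I> < w_k can be reordered into some I_alpha: exchanging two neighbours
    i, j creates terms in [X_i, X_j] = sum of L_k X_k over w_k <= w_i + w_j with
    smooth L_k, that is, shorter words of no larger weight.  Finally psi_k - x_k
    only involves the x_j with w_j < w_k, so that psi has a global polynomial
    inverse and psi o c belongs to the maximal atlas. *)

Set Implicit Arguments.
Unset Strict Implicit.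
Unset Printing Implicit Defensive.

Import Order.TTheory GRing.Theory Num.Theory.

Local Open Scope classical_set_scope.
Local Open Scope ring_scope.

(** * The chain rule for functions of class C^1 *)

Lemma open_near (T : topologicalType) (V : set T) (x : T) :
  open V -> V x -> \forall y \near x, V y.
Proof. by move=> oV Vx; apply: open_nbhs_nbhs. Qed.

Lemma cvg_row (R : realType) (n : nat) (T : Type) (F : set_system T)
    (FF : Filter F) (f : T -> 'rV[R]_n) (l : 'rV[R]_n) :
  (forall j, (fun t => f t 0 j) @ F --> l 0 j) -> f @ F --> l.
Proof.
move=> fl; apply/cvgrPdist_le => /= e e0.
near=> t.
rewrite /Num.Def.normr/= mx_normrE (bigmax_le _ (ltW e0))//= => -[i j] _.
rewrite !mxE/= (ord1 i).
move: j; near: t; apply: filter_forall => /= j.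
exact: ((cvgrPdist_le _ _).1 (fl j)).
Unshelve. all: by end_near. Qed.

Lemma cvg_finite_sum (R : realType) (T I : Type) (F : set_system T)
    (FF : Filter F) (s : seq I) (f : I -> T -> R) (l : I -> R) :
  (forall i, f i @ F --> l i) ->
  (fun t => \sum_(i <- s) f i t) @ F --> \sum_(i <- s) l i.
Proof.
move=> fl; elim: s => [|i s IH].
  rewrite big_nil (_ : (fun _ => _) = fun=> 0); first exact: cvg_cst.
  by rewrite funeqE => t; rewrite big_nil.
rewrite big_cons (_ : (fun _ => _) = f i \+ fun t => \sum_(j <- s) f j t).
  by apply: cvgD.
by rewrite funeqE => t; rewrite big_cons.
Qed.

Lemma norm_coord_le (R : realType) (n : nat) (x : 'rV[R]_n) j : `|x 0 j| <= `|x|.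
Proof.
by rewrite [leRHS]/Num.Def.normr/= mx_normrE; apply/bigmax_geP; right; exists (0, j).
Qed.

Lemma norm_le_coord (R : realType) (n : nat) (x : 'rV[R]_n) (e : R) :
  0 <= e -> (forall j, `|x 0 j| <= e) -> `|x| <= e.
Proof.
move=> e0 xe; rewrite [leLHS]/Num.Def.normr/= mx_normrE (bigmax_le _ e0)//=.
by move=> -[i j] _ /=; rewrite ord1.
Qed.

Lemma derivable_along_continuous (R : realType) (T W : normedModType R)
    (f : T -> W) t v : derivable f t v -> (fun h : R => f (h *: v + t)) @ 0 --> f t.
Proof.
move=> ft.
have : {for 0, continuous (fun h : R => f (h *: v + t))}.
  exact/differentiable_continuous/derivable1_diffP/(derivable1P _ _ _).1.
by rewrite /prop_for /continuous_at scale0r add0r.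
Qed.

Lemma is_derive_line (R : realType) (T W : normedModType R)
    (f : T -> W) u v (t : R) : derivable f (t *: v + u) v ->
  is_derive t 1 (fun s : R => f (s *: v + u)) ('D_v f (t *: v + u)).
Proof.
move=> df.
have E : (fun h : R => h^-1 *: (((fun s : R => f (s *: v + u)) \o shift t) (h *: 1)
            - f (t *: v + u))) =
         (fun h : R => h^-1 *: ((f \o shift (t *: v + u)) (h *: v) - f (t *: v + u))).
  rewrite funeqE => h /=; congr (_ *: (f _ - _)).
  by rewrite [h *: 1]mulr1 scalerDl addrA.
by apply: DeriveDef; rewrite /derivable /derive E.
Qed.

(** The absolute values let increments of either sign, zero included, be treated at once. *)
Lemma MVT_abs (R : realType) (g dg : R -> R) (s : R) :
  (forall t : R, `|t| <= `|s| -> is_derive t 1 g (dg t)) ->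
  exists2 c, `|c| <= `|s| & g s - g 0 = dg c * s.
Proof.
move=> dgP.
have gc t : `|t| <= `|s| -> {for t, continuous g}.
  by move=> /dgP ?; apply/differentiable_continuous/derivable1_diffP/ex_derive.
have [s0|s0] := leP 0 s.
  have inI t : t \in `[0, s]%R -> `|t| <= `|s|.
    by rewrite in_itv/= => /andP[t0 ts]; rewrite !ger0_norm.
  have [||c cs E] := @MVT_segment R g dg 0 s s0.
  - by move=> t ts; apply: dgP; apply: inI; exact: subset_itv_oo_cc ts.
  - by apply/continuous_in_subspaceT => t /[1!inE] ts; apply: gc; exact: inI.
  by exists c; [exact: inI | rewrite E subr0].
have inI t : t \in `[s, 0]%R -> `|t| <= `|s|.
  rewrite in_itv/= => /andP[t0 ts]; rewrite (ler0_norm ts) ler0_norm ?(ltW s0)//.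
  by rewrite lerN2.
have [||c cs E] := @MVT_segment R g dg s 0 (ltW s0).
- by move=> t ts; apply: dgP; apply: inI; exact: subset_itv_oo_cc ts.
- by apply/continuous_in_subspaceT => t /[1!inE] ts; apply: gc; exact: inI.
exists c; first exact: inI.
by rewrite -opprB E sub0r mulrN opprK.
Qed.

Section ChainRule.
Context {R : realType} {n : nat}.
Implicit Types (f : 'rV[R]_n -> R) (V : set 'rV[R]_n).

Lemma norm_unit_vector (i : 'I_n) : `|'e_i : 'rV[R]_n| <= 1.
Proof.
apply: norm_le_coord => // j; rewrite mxE eqxx /=.
by case: eqP => _; rewrite ?normr1 ?normr0.
Qed.

(** By the mean value theorem the slope is a value of the partial derivative near [x], so its
    closeness to the value at [x] is uniform in the base point [u]. This uniformity is what the
    chain rule needs. The product form avoids dividing by [s]. *)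
Lemma partial_slope V f (i : 'I_n) x (e : R) : open V -> V x ->
  (forall y, V y -> derivable f y 'e_i) -> {for x, continuous (partial i f)} ->
  0 < e ->
  exists2 d : R, 0 < d & forall u s, `|x - u| < d -> `|s| < d ->
    exists2 q, f (s *: 'e_i + u) - f u = s * q & `|partial i f x - q| <= e.
Proof.
move=> oV Vx df cf e0.
have /nbhs_normP[d /= d0 dP] : \forall y \near x,
    V y /\ `|partial i f x - partial i f y| <= e.
  apply: filterI; first by have := open_near oV Vx.
  by move/cvgrPdist_le : cf => /(_ _ e0).
(* Half of [d] is spent on moving from [x] to [u] and half on moving along ['e_i], so the whole
   segment stays in the ball of radius [d]. *)
exists (d / 2); first by rewrite divr_gt0.
move=> u s ud sd.
have near t : `|t| <= `|s| ->
    V (t *: 'e_i + u) /\ `|partial i f x - partial i f (t *: 'e_i + u)| <= e.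
  move=> ts; apply: dP; rewrite /ball_/= opprD addrCA addrC.
  rewrite (le_lt_trans (ler_normB _ _))// (splitr d) ltrD//.
  rewrite normrZ (le_lt_trans _ sd)// (le_trans _ ts)//.
  by rewrite ler_piMr// norm_unit_vector.
have [t ts|c cs E] := @MVT_abs R (fun t => f (t *: 'e_i + u))
  (fun t => partial i f (t *: 'e_i + u)) s.
  by apply: is_derive_line; apply: df; apply: (near t ts).1.
exists (partial i f (c *: 'e_i + u)); last exact: (near c cs).2.
by rewrite mulrC -E scale0r add0r.
Qed.

(** The increment of [f] is telescoped by changing one coordinate at a time; each step has the form
    increment times slope, and the slopes converge by [partial_slope]. *)
Lemma is_derive_comp_C1 (T : normedModType R) V f (G : T -> 'rV[R]_n) t v :
  open V -> V (G t) -> is_Ck 1 V f ->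
  (forall j, derivable (fun t => G t 0 j) t v) ->
  is_derive t v (f \o G) (\sum_j partial j f (G t) * 'D_v (fun t => G t 0 j) t).
Proof.
move=> oV Vx [_ C1] dG.
pose x := G t; pose g (h : R) := G (h *: v + t).
have gx : g @ (0 : R)^' --> x.
  apply: cvg_row => j; apply: cvg_trans (derivable_along_continuous (dG j)).
  by apply: cvg_app; apply: cvg_within.
(* Intermediate points: the first [m] coordinates have moved to [g h], the others are still those of
   [x]. *)
pose z h m : 'rV[R]_n := \row_j if (j < m)%N then g h 0 j else x 0 j.
pose s h (m : 'I_n) := g h 0 m - x 0 m.
(* When the coordinate does not move, the slope is set to its expected limit, which keeps both the
   factorization [fE] and the convergence [qx] true. *)
pose q h (m : 'I_n) := if s h m == 0 then partial m f x else
   (f (s h m *: 'e_m + z h m) - f (z h m)) / s h m.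
have zS h (m : 'I_n) : z h m.+1 = s h m *: 'e_m + z h m.
  apply/rowP => j; rewrite !mxE eqxx /= ltnS leq_eqVlt.
  case: (eqVneq j m) => [->|jm]; first by rewrite eqxx ltnn mulr1 subrK.
  by rewrite mulr0 add0r -(inj_eq val_inj) in jm *; rewrite (negbTE jm).
have fE h : f (g h) - f x = \sum_m s h m * q h m.
  have -> : g h = z h n by apply/rowP => j; rewrite mxE ltn_ord.
  have -> : x = z h 0%N by apply/rowP => j; rewrite mxE.
  rewrite -(telescope_sumr (fun m => f (z h m)))// big_mkord; apply: eq_bigr => m _.
  rewrite zS /q; case: eqVneq => [->|s0].
    by rewrite scale0r add0r subrr mul0r.
  by rewrite mulrC divfK.
have qx m : q ^~ m @ (0 : R)^' --> partial m f x.
  apply/cvgrPdist_le => /= e e0.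
  have [dm cm] := C1 m.
  have [d d0 dP] := partial_slope oV Vx dm (cm.1 _ Vx) e0.
  have gd' : \forall h \near (0 : R)^', `|x - g h| < d.
    by move/cvgrPdist_lt : gx => /(_ _ d0).
  near=> h; rewrite /q; case: eqVneq => [_|s0]; first by rewrite subrr normr0 ltW.
  have gd : `|x - g h| < d by near: h.
  have [||p E pe] := dP (z h m) (s h m).
  - apply: le_lt_trans gd; apply: norm_le_coord => // j; rewrite !mxE.
    case: ifP => _; last by rewrite subrr normr0.
    by have := norm_coord_le (x - g h) j; rewrite !mxE.
  - apply: le_lt_trans gd; rewrite distrC.
    by have := norm_coord_le (x - g h) m; rewrite !mxE.
  by rewrite E mulrC mulKf.
have key : (fun h => h^-1 *: (((f \o G) \o shift t) (h *: v) - (f \o G) t)) @ (0 : R)^'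
   --> \sum_j partial j f (G t) * 'D_v (fun t => G t 0 j) t.
  have -> : (fun h => h^-1 *: (((f \o G) \o shift t) (h *: v) - (f \o G) t)) =
    (fun h => \sum_m q h m * (h^-1 *: s h m)).
    rewrite funeqE => h /=; rewrite [f (G _) - f _]fE scaler_sumr; apply: eq_bigr => m _.
    by rewrite [LHS]mulrA [LHS]mulrC.
  apply: cvg_finite_sum => j.
  by apply: cvgM; [exact: qx | exact: (dG j)].
by apply: DeriveDef; [apply/cvg_ex; eexists; exact: key | apply: cvg_lim key].
Unshelve. all: by end_near. Qed.

End ChainRule.

(** * Functions of class C^k *)

Section SmoothCalculus.
Context {R : realType} {n : nat}.
Implicit Types (f g : 'rV[R]_n -> R) (V : set 'rV[R]_n).

Lemma continuous_eq_near (S T : topologicalType) (f g : S -> T) x :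
  {near x, f =1 g} -> {for x, continuous f} -> {for x, continuous g}.
Proof.
move=> fg fc; rewrite /prop_for /continuous_at -(nbhs_singleton fg).
exact: cvg_trans (near_eq_cvg fg) fc.
Qed.

Lemma is_Ck_continuous k V f x : is_Ck k V f -> V x -> {for x, continuous f}.
Proof. by case: k => [|k] [fc _]; exact: fc. Qed.

Lemma is_CkW k V f : is_Ck k.+1 V f -> is_Ck k V f.
Proof.
elim: k f => [|k IH] f [fc fd]; first by split.
by split=> // i; have [fdi /IH ?] := fd i.
Qed.

Lemma is_Ck_le k m V f : (k <= m)%N -> is_Ck m V f -> is_Ck k V f.
Proof. by move=> /subnK <-; elim: (m - k)%N => // j IH /is_CkW. Qed.

Lemma is_Ck_subset k V V' f : V' `<=` V -> is_Ck k V f -> is_Ck k V' f.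
Proof.
move=> VV'; elim: k f => [|k IH] f [fc fd]; split=> //.
- by move=> x /VV'; exact: fc.
- by move=> x /VV'; exact: fc.
by move=> i; have [fdi /IH ?] := fd i; split => // x /VV'; exact: fdi.
Qed.

Lemma is_Ck_eq k V f g : open V -> (forall x, V x -> f x = g x) ->
  is_Ck k V f -> is_Ck k V g.
Proof.
move=> oV; elim: k f g => [|k IH] f g fg fC.
  split=> // x Vx; have [fc _] := fC; apply: continuous_eq_near (fc _ Vx).
  by apply: filterS (open_near oV Vx) => y /fg.
have fgx x : V x -> {near x, f =1 g}.
  by move=> Vx; apply: filterS (open_near oV Vx) => y /fg.
have [fc fd] := fC; split=> [x Vx|i].
  exact: continuous_eq_near (fgx _ Vx) (fc _ Vx).
have [fdi fCi] := fd i; split=> [x Vx|].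
  exact: near_eq_derivable (fgx _ Vx) (fdi _ Vx).
apply: IH fCi => x Vx; exact: near_eq_derive (fgx _ Vx).
Qed.

(** Lets the partial derivatives be given by formulas valid on [V] only; since [V] is open,
    regularity passes from the formulas to [partial i f]. *)
Lemma is_CkS_derive k V f (df : 'I_n -> 'rV[R]_n -> R) : open V ->
  (forall x, V x -> {for x, continuous f}) ->
  (forall i x, V x -> is_derive x ('e_i : 'rV[R]_n) f (df i x)) ->
  (forall i, is_Ck k V (df i)) -> is_Ck k.+1 V f.
Proof.
move=> oV fc fd dfC; split=> // i; split=> [x Vx|].
  by have [] := fd i x Vx.
apply: is_Ck_eq (dfC i) => // x Vx.
by have [_ <-] := fd i x Vx.
Qed.

Lemma is_Ck_is_derive k V f i x : is_Ck k.+1 V f -> V x ->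
  is_derive x ('e_i : 'rV[R]_n) f (partial i f x).
Proof. by move=> [_ /(_ i)[fd _]] Vx; apply: derivableP; exact: fd. Qed.

Lemma is_Ck_partial k V f i : is_Ck k.+1 V f -> is_Ck k V (partial i f).
Proof. by case=> _ /(_ i)[]. Qed.

Lemma is_Ck_cst k V (a : R) : open V -> is_Ck k V (fun=> a).
Proof.
move=> oV; elim: k a => [|k IH] a; first by split=> // x _; exact: cst_continuous.
apply: (@is_CkS_derive k V _ (fun _ _ => 0)) => // x Vx; exact: cst_continuous.
Qed.

Lemma is_derive_coord (i j : 'I_n) (x : 'rV[R]_n) :
  is_derive x ('e_i : 'rV[R]_n) (fun x : 'rV[R]_n => x 0 j) ((j == i)%:R : R).
Proof.
have E : (fun h : R => h^-1 *:
     (((fun x : 'rV[R]_n => x 0 j) \o shift x) (h *: 'e_i) - x 0 j))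
   @ (0 : R)^' --> ((j == i)%:R : R).
  apply: (@cvg_trans _ (cst ((j == i)%:R : R) @ (0 : R)^')); last exact: cvg_cst.
  apply: near_eq_cvg; near=> h.
  rewrite /cst /= !mxE eqxx /= addrK [RHS]mulrA mulVf ?mul1r//.
  by near: h; exact: nbhs_dnbhs_neq.
by apply: DeriveDef; [apply/cvg_ex; eexists; exact: E | apply: cvg_lim E].
Unshelve. all: by end_near. Qed.

Lemma is_Ck_coord k V (j : 'I_n) : open V ->
  is_Ck k V (fun x : 'rV[R]_n => x 0 j).
Proof.
move=> oV; case: k => [|k]; first by split=> // x _; exact: coord_continuous.
apply: (@is_CkS_derive k V _ (fun i _ => (j == i)%:R)) => //.
- by move=> x _; exact: coord_continuous.
- by move=> i x _; exact: is_derive_coord.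
- by move=> i; exact: is_Ck_cst.
Qed.

Lemma is_CkD k V f g : open V -> is_Ck k V f -> is_Ck k V g ->
  is_Ck k V (fun x => f x + g x).
Proof.
move=> oV; elim: k f g => [|k IH] f g fC gC.
  split=> // x Vx.
  exact: (cvgD (is_Ck_continuous fC Vx) (is_Ck_continuous gC Vx)).
apply: (@is_CkS_derive k V _ (fun i x => partial i f x + partial i g x)) => //.
- move=> x Vx.
  exact: (cvgD (is_Ck_continuous fC Vx) (is_Ck_continuous gC Vx)).
- move=> i x Vx; have ? := is_Ck_is_derive i fC Vx.
  by have ? := is_Ck_is_derive i gC Vx; exact: is_deriveD.
- by move=> i; apply: IH; exact: is_Ck_partial.
Qed.

Lemma is_CkM k V f g : open V -> is_Ck k V f -> is_Ck k V g ->
  is_Ck k V (fun x => f x * g x).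
Proof.
move=> oV; elim: k f g => [|k IH] f g fC gC.
  split=> // x Vx.
  exact: (cvgM (is_Ck_continuous fC Vx) (is_Ck_continuous gC Vx)).
apply: (@is_CkS_derive k V _ (fun i x => f x * partial i g x + g x * partial i f x)) => //.
- move=> x Vx.
  exact: (cvgM (is_Ck_continuous fC Vx) (is_Ck_continuous gC Vx)).
- move=> i x Vx; have ? := is_Ck_is_derive i fC Vx.
  by have ? := is_Ck_is_derive i gC Vx; exact: is_deriveM.
- move=> i; apply: is_CkD => //; apply: IH => //;
    by [exact: is_CkW | exact: is_Ck_partial].
Qed.

Lemma is_CkV k V g : open V -> (forall x, V x -> g x != 0) -> is_Ck k V g ->
  is_Ck k V (fun x => (g x)^-1).
Proof.
move=> oV g0; elim: k => [|k IH] gC.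
  by split=> // x Vx; exact: (cvgV (g0 _ Vx) (is_Ck_continuous gC Vx)).
have gVC := IH (is_CkW gC).
(* The derivative is written in terms of the inverse itself, so that the induction hypothesis [gVC]
   applies to it. *)
apply: (@is_CkS_derive k V _ (fun i x => -1 * ((g x)^-1 * (g x)^-1) * partial i g x)) => //.
- by move=> x Vx; exact: (cvgV (g0 _ Vx) (is_Ck_continuous gC Vx)).
- move=> i x Vx; have [gd _] := is_Ck_is_derive i gC Vx.
  apply: DeriveDef; first by apply: derivableV => //; exact: g0.
  by rewrite deriveV ?g0// mulN1r -invfM -expr2.
- move=> i; apply: is_CkM (is_Ck_partial i gC) => //.
  by apply: is_CkM => //; [exact: is_Ck_cst|exact: is_CkM].
Qed.

Lemma is_Ck_sum (I : Type) (s : seq I) (P : pred I) (F : I -> 'rV[R]_n -> R) k V :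
  open V -> (forall i, is_Ck k V (F i)) ->
  is_Ck k V (fun x => \sum_(i <- s | P i) F i x).
Proof.
move=> oV FC; elim: s => [|i s IH].
  by apply: is_Ck_eq (is_Ck_cst k 0 oV) => // x _; rewrite big_nil.
case: (boolP (P i)) => Pi.
  apply: is_Ck_eq (is_CkD oV (FC i) IH) => // x _; by rewrite big_cons Pi.
by apply: is_Ck_eq IH => // x _; rewrite big_cons (negbTE Pi).
Qed.

Lemma is_Ck_prod (I : Type) (s : seq I) (P : pred I) (F : I -> 'rV[R]_n -> R) k V :
  open V -> (forall i, is_Ck k V (F i)) ->
  is_Ck k V (fun x => \prod_(i <- s | P i) F i x).
Proof.
move=> oV FC; elim: s => [|i s IH].
  by apply: is_Ck_eq (is_Ck_cst k 1 oV) => // x _; rewrite big_nil.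
case: (boolP (P i)) => Pi.
  apply: is_Ck_eq (is_CkM oV (FC i) IH) => // x _; by rewrite big_cons Pi.
by apply: is_Ck_eq IH => // x _; rewrite big_cons (negbTE Pi).
Qed.

(** The induction on [k] quantifies over [f], because the chain rule composes [G] with the partial
    derivatives of [f]. *)
Lemma is_Ck_comp k V V' f (G : 'rV[R]_n -> 'rV[R]_n) : open V -> open V' ->
  (forall x, V x -> V' (G x)) -> is_Ck k V' f ->
  (forall j, is_Ck k V (fun x => G x 0 j)) -> is_Ck k V (f \o G).
Proof.
move=> oV oV' GV.
have Gc m : (forall j, is_Ck m V (fun x => G x 0 j)) ->
    forall x, V x -> {for x, continuous G}.
  move=> GC x Vx; apply: (@cvg_row _ _ _ (nbhs x) (nbhs_filter x) G) => j.
  exact: is_Ck_continuous (GC j) Vx.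
elim: k f => [|k IH] f fC GC.
  split=> // x Vx; apply: continuous_comp; first exact: Gc GC _ Vx.
  exact: is_Ck_continuous fC (GV _ Vx).
apply: (@is_CkS_derive k V _ (fun i x => \sum_j
  partial j f (G x) * partial i (fun x => G x 0 j) x)) => //.
- move=> x Vx; apply: continuous_comp; first exact: Gc GC _ Vx.
  exact: is_Ck_continuous fC (GV _ Vx).
- move=> i x Vx; apply: (is_derive_comp_C1 oV' (GV _ Vx) (is_Ck_le _ fC)) => // j.
  by have [] := is_Ck_is_derive i (GC j) Vx.
- move=> i; apply: is_Ck_sum => // j; apply: is_CkM => //; last exact: is_Ck_partial.
  by apply: IH; [exact: is_Ck_partial|move=> l; exact: is_CkW].
Qed.

End SmoothCalculus.

(** * Smooth functions and tangent vectors on a manifold *)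

Lemma chart_preimage_open (R : realType) (n : nat) (M : topologicalType)
    (c : chart R n M) (W : set M) :
  open W -> open (cimg c `&` cinv c @^-1` W).
Proof.
move=> oW; rewrite openE => x [xi xW]; apply: filterI.
  by have := open_near (@cimg_open _ _ _ c) xi.
by apply: (cinv_continuous xi); have := open_near oW xW.
Qed.

Section SmoothFunctions.
Context {R : realType} {n : nat} {M : manifold R n}.
Implicit Types (f g : M -> R) (W : set M) (p : M) (c : chart R n M).

Definition coordinate c (k : 'I_n) : M -> R := fun p => c p 0 k.

Lemma smooth_on_subset W W' f : W' `<=` W -> smooth_on W f -> smooth_on W' f.
Proof.
move=> WW' fS c ca k; apply: is_Ck_subset (fS c ca k).
by move=> x [xi xW]; split => //; exact: WW'.
Qed.

Lemma smooth_on_cst W (a : R) : open W -> smooth_on W (fun=> a).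
Proof.
by move=> oW c ca k; apply: is_Ck_cst; exact: chart_preimage_open.
Qed.

Lemma smooth_on_eq W f g : open W -> (forall p, W p -> f p = g p) ->
  smooth_on W f -> smooth_on W g.
Proof.
move=> oW fg fS c ca k; apply: is_Ck_eq (fS c ca k).
  exact: chart_preimage_open.
by move=> x [_ xW]; exact: fg.
Qed.

Lemma smooth_onD W f g : open W -> smooth_on W f -> smooth_on W g ->
  smooth_on W (fun p => f p + g p).
Proof.
move=> oW fS gS c ca k.
exact: (is_CkD (chart_preimage_open oW) (fS c ca k) (gS c ca k)).
Qed.

Lemma smooth_onM W f g : open W -> smooth_on W f -> smooth_on W g ->
  smooth_on W (fun p => f p * g p).
Proof.
move=> oW fS gS c ca k.
exact: (is_CkM (chart_preimage_open oW) (fS c ca k) (gS c ca k)).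
Qed.

Lemma smooth_onV W g : open W -> (forall p, W p -> g p != 0) ->
  smooth_on W g -> smooth_on W (fun p => (g p)^-1).
Proof.
move=> oW g0 gS c ca k.
apply: (is_CkV (g := g \o cinv c) (chart_preimage_open oW) _ (gS c ca k)).
by move=> x [_ xW]; exact: g0.
Qed.

Lemma smooth_on_sum W (I : Type) (s : seq I) (P : pred I) (F : I -> M -> R) :
  open W -> (forall i, smooth_on W (F i)) ->
  smooth_on W (fun p => \sum_(i <- s | P i) F i p).
Proof.
move=> oW FS c ca k.
apply: (is_Ck_sum s P (F := fun i => F i \o cinv c) (chart_preimage_open oW)).
by move=> i; exact: FS.
Qed.

Lemma smooth_on_prod W (I : Type) (s : seq I) (P : pred I) (F : I -> M -> R) :
  open W -> (forall i, smooth_on W (F i)) ->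
  smooth_on W (fun p => \prod_(i <- s | P i) F i p).
Proof.
move=> oW FS c ca k.
apply: (is_Ck_prod s P (F := fun i => F i \o cinv c) (chart_preimage_open oW)).
by move=> i; exact: FS.
Qed.

Lemma smooth_on_coordinate W c k : atlas c -> W `<=` cdom c ->
  smooth_on W (coordinate c k).
Proof.
move=> ca Wc c' ca' m; apply: is_Ck_subset (atlas_compatible ca' ca k m).
by move=> x [xi xW]; split => //; exact: Wc.
Qed.

Lemma smooth_on_at W p f : open W -> W p -> smooth_on W f -> smooth_at p f.
Proof. by move=> oW Wp fS; exists W. Qed.

Lemma smooth_atD p f g : smooth_at p f -> smooth_at p g ->
  smooth_at p (fun q => f q + g q).
Proof.
move=> [W [oW Wp fS]] [W' [oW' Wp' gS]].
exists (W `&` W'); split => //; first exact: openI.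
apply: smooth_onD; first exact: openI.
  by apply: smooth_on_subset fS => q [].
by apply: smooth_on_subset gS => q [].
Qed.

Lemma smooth_atM p f g : smooth_at p f -> smooth_at p g ->
  smooth_at p (fun q => f q * g q).
Proof.
move=> [W [oW Wp fS]] [W' [oW' Wp' gS]].
exists (W `&` W'); split => //; first exact: openI.
apply: smooth_onM; first exact: openI.
  by apply: smooth_on_subset fS => q [].
by apply: smooth_on_subset gS => q [].
Qed.

Lemma smooth_at_coordinate c p k : atlas c -> cdom c p ->
  smooth_at p (coordinate c k).
Proof.
move=> ca cp; exists (cdom c); split => //; first exact: cdom_open.
exact: smooth_on_coordinate.
Qed.

Lemma smooth_at_chart p f c : smooth_at p f -> atlas c -> cdom c p ->
  exists V, [/\ open V, V (c p), V `<=` cimg c & is_Cinfty V (f \o cinv c)].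
Proof.
move=> [W [oW Wp fS]] ca cp; exists (cimg c `&` cinv c @^-1` W); split.
- exact: chart_preimage_open.
- by split; [exact: cmap_img | rewrite /= cmapK].
- by move=> x [].
- exact: fS.
Qed.

Lemma is_derive_chart p f c i : smooth_at p f -> atlas c -> cdom c p ->
  is_derive (c p) ('e_i : 'rV[R]_n) (f \o cinv c) (coord_vector c p i f).
Proof.
move=> fp ca cp; have [V [oV Vx _ fC]] := smooth_at_chart fp ca cp.
exact: is_Ck_is_derive (fC 1%N) Vx.
Qed.

Lemma coord_vector_eq W c p i f g : open W -> W p -> cdom c p ->
  (forall q, W q -> f q = g q) -> coord_vector c p i f = coord_vector c p i g.
Proof.
move=> oW Wp cp fg; apply: near_eq_derive.
have Vp : (cimg c `&` cinv c @^-1` W) (c p).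
  by split; [exact: cmap_img | rewrite /= cmapK].
by apply: filterS (open_near (chart_preimage_open oW) Vp) => x [_ /fg].
Qed.

Lemma coord_vectorD c p i f g : atlas c -> cdom c p ->
  smooth_at p f -> smooth_at p g ->
  coord_vector c p i (fun q => f q + g q) = coord_vector c p i f + coord_vector c p i g.
Proof.
move=> ca cp fp gp; have df := is_derive_chart i fp ca cp.
have dg := is_derive_chart i gp ca cp.
by have [_] := is_deriveD df dg.
Qed.

Lemma coord_vectorM c p i f g : atlas c -> cdom c p ->
  smooth_at p f -> smooth_at p g ->
  coord_vector c p i (fun q => f q * g q) =
    coord_vector c p i f * g p + f p * coord_vector c p i g.
Proof.
move=> ca cp fp gp; have df := is_derive_chart i fp ca cp.
have dg := is_derive_chart i gp ca cp.
have [_] := is_deriveM df dg; rewrite /= cmapK// => E.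
by rewrite [LHS]E addrC mulrC.
Qed.

Lemma coord_vector_cst c p i (a : R) : coord_vector c p i (fun=> a) = 0.
Proof. exact: derive_cst. Qed.

Lemma coord_vector_coordinate c p i k : cdom c p ->
  coord_vector c p i (coordinate c k) = (k == i)%:R.
Proof.
move=> cp; have [_ <-] := is_derive_coord i k (c p).
apply: near_eq_derive; apply: filterS (open_near (@cimg_open _ _ _ c) (cmap_img cp)).
by move=> x xi; rewrite /= /coordinate cinvK.
Qed.

(** This is the chain rule for the transition map from [c1] to [c]. *)
Lemma coord_vector_change c1 c p i f : atlas c1 -> cdom c1 p ->
  atlas c -> cdom c p -> smooth_at p f ->
  coord_vector c1 p i f =
    \sum_m coord_vector c1 p i (coordinate c m) * coord_vector c p m f.
Proof.
move=> c1a c1p ca cp fp.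
have [V [oV Vx Vi fC]] := smooth_at_chart fp ca cp.
pose G := fun x => c (cinv c1 x).
have Gx : G (c1 p) = c p by rewrite /G cmapK.
have [||_] := @is_derive_comp_C1 _ _ _ V (f \o cinv c) G (c1 p) 'e_i oV _ (fC 1%N).
- by rewrite Gx.
- move=> j; have := is_derive_chart i (smooth_at_coordinate j ca cp) c1a c1p.
  by case.
rewrite Gx => E.
have -> : coord_vector c1 p i f = 'D_('e_i) ((f \o cinv c) \o G) (c1 p).
  apply: near_eq_derive.
  have Wp : (cimg c1 `&` cinv c1 @^-1` cdom c) (c1 p).
    by split; [exact: cmap_img | rewrite /= cmapK].
  apply: filterS (open_near (chart_preimage_open (@cdom_open _ _ _ c)) Wp) => x [_ xc].
  by rewrite /= /G cmapK.
by rewrite E; apply: eq_bigr => m _; rewrite mulrC.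
Qed.

Section TangentVectors.
Variables (p : M) (v : functional M).
Hypothesis tv : tangent p v.

Lemma tangentD f g : smooth_at p f -> smooth_at p g ->
  v (fun q => f q + g q) = v f + v g.
Proof.
move: tv => [c [ca cp [u vE]]] fp gp.
have fgp := smooth_atD fp gp.
rewrite !vE// /lin_comb -big_split; apply: eq_bigr => i _ /=.
by rewrite coord_vectorD// mulrDr.
Qed.

Lemma tangentM f g : smooth_at p f -> smooth_at p g ->
  v (fun q => f q * g q) = v f * g p + f p * v g.
Proof.
move: tv => [c [ca cp [u vE]]] fp gp.
have fgp := smooth_atM fp gp.
rewrite !vE// /lin_comb mulr_suml mulr_sumr -big_split; apply: eq_bigr => i _ /=.
by rewrite coord_vectorM// mulrDr mulrA mulrCA.
Qed.

Lemma tangent_cst (a : R) : v (fun=> a) = 0.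
Proof.
move: tv => [c [ca cp [u vE]]].
have ap : smooth_at p (fun=> a).
  exists (cdom c); split => //; first exact: cdom_open.
  by apply: smooth_on_cst; exact: cdom_open.
by rewrite vE// /lin_comb big1// => i _; rewrite coord_vector_cst mulr0.
Qed.

Lemma tangent_eq W f g : open W -> W p -> smooth_on W f ->
  (forall q, W q -> f q = g q) -> v f = v g.
Proof.
move: tv => [c [ca cp [u vE]]] oW Wp fS fg.
have fp := smooth_on_at oW Wp fS.
have gp := smooth_on_at oW Wp (smooth_on_eq oW fg fS).
rewrite !vE//.
by apply: eq_bigr => i _; rewrite (coord_vector_eq _ oW Wp cp fg).
Qed.

(** [tangent] only provides some chart at [p]; changing charts gives an expansion in any chart,
    whose coefficients are the values of [v] on the coordinate functions. *)
Lemma tangent_coord c f : atlas c -> cdom c p -> smooth_at p f ->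
  v f = \sum_m v (coordinate c m) * coord_vector c p m f.
Proof.
move: tv => [c1 [c1a c1p [u vE]]] ca cp fp; rewrite vE// /lin_comb.
transitivity (\sum_i \sum_m u 0 i * (coord_vector c1 p i (coordinate c m) *
    coord_vector c p m f)).
  by apply: eq_bigr => i _; rewrite (coord_vector_change i c1a c1p ca cp fp) mulr_sumr.
rewrite exchange_big; apply: eq_bigr => m _ /=.
rewrite vE; last exact: smooth_at_coordinate.
by rewrite /lin_comb mulr_suml; apply: eq_bigr => i _; rewrite mulrA.
Qed.

End TangentVectors.

Lemma coord_vector_tangent c p i : atlas c -> cdom c p -> tangent p (coord_vector c p i).
Proof.
move=> ca cp; exists c; split => //; exists 'e_i => f fp.
rewrite /lin_comb (bigD1 i)//= mxE !eqxx mul1r big1 ?addr0// => j ji.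
by rewrite mxE (negbTE ji) mul0r.
Qed.

Lemma tangent_eq_coordinates c p (v w : functional M) : tangent p v -> tangent p w ->
  atlas c -> cdom c p ->
  (forall k, v (coordinate c k) = w (coordinate c k)) -> tv_eq p v w.
Proof.
move=> tv tw ca cp vw f fp; rewrite (tangent_coord tv ca cp fp).
by rewrite (tangent_coord tw ca cp fp); apply: eq_bigr => k _; rewrite vw.
Qed.

End SmoothFunctions.

(** * Composition of a chart with a smooth diffeomorphism of the model space *)

Section ChartChange.
Context {R : realType} {n : nat} {M : manifold R n}.
Variables (c : chart R n M) (psi phi : 'rV[R]_n -> 'rV[R]_n).
Hypotheses (ca : atlas c) (psiK : cancel psi phi) (phiK : cancel phi psi).
Hypothesis psiC : forall k, is_Cinfty setT (fun x => psi x 0 k).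
Hypothesis phiC : forall k, is_Cinfty setT (fun x => phi x 0 k).

Lemma is_Cinfty_row_continuous (g : 'rV[R]_n -> 'rV[R]_n) :
  (forall k, is_Cinfty setT (fun x => g x 0 k)) ->
  forall x, {for x, continuous g}.
Proof.
move=> gC x; apply: (@cvg_row _ _ _ (nbhs x) (nbhs_filter x) g) => j.
exact: is_Ck_continuous (gC j 0%N) _.
Qed.

Lemma chart_change_img_open : open (phi @^-1` cimg c).
Proof.
rewrite openE => x xi; apply: (is_Cinfty_row_continuous phiC).
by have := open_near (@cimg_open _ _ _ c) xi.
Qed.

Program Definition chart_change : chart R n M :=
  @Chart R n M (cdom c) (phi @^-1` cimg c) (psi \o c) (cinv c \o phi)
    (@cdom_open _ _ _ c) chart_change_img_open _ _ _ _ _ _.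
Next Obligation. by move=> p cp; rewrite /preimage/= psiK; exact: cmap_img. Qed.
Next Obligation. by move=> x xi; exact: cinv_dom. Qed.
Next Obligation. by move=> p cp; rewrite /= psiK cmapK. Qed.
Next Obligation. by move=> x xi; rewrite /= cinvK. Qed.
Next Obligation.
move=> p cp; apply: continuous_comp; first exact: cmap_continuous.
exact: is_Cinfty_row_continuous.
Qed.
Next Obligation.
move=> x xi; apply: continuous_comp; first exact: is_Cinfty_row_continuous.
exact: cinv_continuous.
Qed.

(** By maximality it suffices to compare with every chart of the atlas: the transitions are those of
    [c] composed with [phi] on the right or with [psi] on the left. *)
Lemma chart_change_atlas : atlas chart_change.
Proof.
apply: atlas_maximal => c' c'a; split=> k m /=.
  apply: (@is_Ck_comp _ _ _ _ (cimg c `&` cinv c @^-1` cdom c')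
    (fun x => c' (cinv c x) 0 k) phi).
  - exact: (@chart_preimage_open _ _ _ chart_change _ (@cdom_open _ _ _ c')).
  - exact: (chart_preimage_open (@cdom_open _ _ _ c')).
  - by move=> x [].
  - exact: atlas_compatible.
  - by move=> j; apply: is_Ck_subset (phiC j m).
apply: (@is_Ck_comp _ _ _ _ setT (fun x => psi x 0 k) (fun x => c (cinv c' x))) => //.
- exact: (chart_preimage_open (@cdom_open _ _ _ c)).
- exact: openT.
- exact: psiC.
- by move=> j; exact: (atlas_compatible c'a ca).
Qed.

End ChartChange.

(** * Iterated derivatives along words *)

Lemma vector_field_subset (R : realType) (n : nat) (M : manifold R n)
    (U W : set M) (Y : field_on M) :
  W `<=` U -> vector_field U Y -> vector_field W Y.
Proof.
move=> WU [tY sY]; split=> [p /WU|V f oV VW]; first exact: tY.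
by apply: sY => // p /VW /WU.
Qed.

Section Words.
Context {R : realType} {n r : nat} {M : carnot_manifold R n r}.
Variables (X : 'I_n -> field_on M) (W : set M).
Hypotheses (oW : open W) (XW : forall i, vector_field W (X i)).
Implicit Types (f g : M -> R) (p : M) (I J : seq 'I_n).

Lemma act_smooth i f : smooth_on W f -> smooth_on W (act (X i) f).
Proof. by move=> fS; apply: (XW i).2. Qed.

Lemma iter_act_smooth I f : smooth_on W f -> smooth_on W (iter_act X I f).
Proof. by move=> fS; elim: I => //= i I IH; exact: act_smooth. Qed.

Lemma act_eq i f g p : smooth_on W f -> (forall q, W q -> f q = g q) -> W p ->
  act (X i) f p = act (X i) g p.
Proof. by move=> fS fg Wp; exact: (tangent_eq ((XW i).1 _ Wp) oW Wp fS fg). Qed.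

Lemma actD i f g p : smooth_on W f -> smooth_on W g -> W p ->
  act (X i) (fun q => f q + g q) p = act (X i) f p + act (X i) g p.
Proof.
move=> fS gS Wp; exact: (tangentD ((XW i).1 _ Wp) (smooth_on_at oW Wp fS)
  (smooth_on_at oW Wp gS)).
Qed.

Lemma actM i f g p : smooth_on W f -> smooth_on W g -> W p ->
  act (X i) (fun q => f q * g q) p = act (X i) f p * g p + f p * act (X i) g p.
Proof.
move=> fS gS Wp; exact: (tangentM ((XW i).1 _ Wp) (smooth_on_at oW Wp fS)
  (smooth_on_at oW Wp gS)).
Qed.

Lemma act_cst i (b : R) p : W p -> act (X i) (fun=> b) p = 0.
Proof. by move=> Wp; exact: (tangent_cst ((XW i).1 _ Wp)). Qed.

Lemma iter_act_rcons I i f : iter_act X (rcons I i) f = iter_act X I (act (X i) f).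
Proof. by rewrite /iter_act foldr_rcons. Qed.

Lemma iter_act_cat I J f : iter_act X (I ++ J) f = iter_act X I (iter_act X J f).
Proof. by rewrite /iter_act foldr_cat. Qed.

Lemma iter_act_eq I f g p : smooth_on W f -> (forall q, W q -> f q = g q) -> W p ->
  iter_act X I f p = iter_act X I g p.
Proof.
move=> fS fg; elim: I p => [|i I IH] p Wp /=; first exact: fg.
exact: act_eq (iter_act_smooth I fS) IH Wp.
Qed.

Lemma iter_actD I f g p : smooth_on W f -> smooth_on W g -> W p ->
  iter_act X I (fun q => f q + g q) p = iter_act X I f p + iter_act X I g p.
Proof.
move=> fS gS; elim: I p => [|i I IH] p Wp //=.
rewrite (act_eq _ (iter_act_smooth I (smooth_onD oW fS gS)) IH Wp).
by rewrite actD//; exact: iter_act_smooth.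
Qed.

Lemma iter_actZ I (b : R) f p : smooth_on W f -> W p ->
  iter_act X I (fun q => b * f q) p = b * iter_act X I f p.
Proof.
move=> fS; have bS := smooth_on_cst b oW.
elim: I p => [|i I IH] p Wp //=.
rewrite (act_eq _ (iter_act_smooth I (smooth_onM oW bS fS)) IH Wp).
rewrite (actM _ bS)//; last exact: iter_act_smooth.
by rewrite act_cst// mul0r add0r.
Qed.

Lemma iter_act_sum (T : Type) (s : seq T) (P : pred T) (F : T -> M -> R) I p :
  (forall t, smooth_on W (F t)) -> W p ->
  iter_act X I (fun q => \sum_(t <- s | P t) F t q) p =
  \sum_(t <- s | P t) iter_act X I (F t) p.
Proof.
move=> FS Wp; elim: s => [|t s IH].
  rewrite big_nil -[RHS](mul0r (iter_act X I (fun=> 0) p)) -iter_actZ//;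
    last exact: smooth_on_cst.
  apply: iter_act_eq => //; last by move=> q _; rewrite big_nil mul0r.
  by apply: smooth_on_sum.
rewrite big_cons; case: ifP => Pt.
  rewrite -IH -iter_actD//; last exact: smooth_on_sum.
  by apply: iter_act_eq => //; [exact: smooth_on_sum | move=> q _; rewrite big_cons Pt].
rewrite -IH; apply: iter_act_eq => //; first exact: smooth_on_sum.
by move=> q _; rewrite big_cons Pt.
Qed.

(** * Unweighted order of vanishing at [a] *)

Variable a : M.
Hypothesis Wa : W a.

(** The counterpart of [order_ge] in which words are measured by length instead of weight; it
    controls the leading terms of monomials. *)
Definition flat N f := smooth_on W f /\
  forall I, (size I < N)%N -> iter_act X I f a = 0.

Lemma flat_eq N f g : (forall p, W p -> f p = g p) -> flat N f -> flat N g.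
Proof.
move=> fg [fS fN]; split; first exact: smooth_on_eq fS.
by move=> I IN; rewrite -(iter_act_eq I fS fg Wa) fN.
Qed.

Lemma flatD N f g : flat N f -> flat N g -> flat N (fun p => f p + g p).
Proof.
move=> [fS fN] [gS gN]; split; first exact: smooth_onD.
by move=> I IN; rewrite iter_actD// fN// gN// addr0.
Qed.

Lemma flat_act N f i : flat N f -> flat N.-1 (act (X i) f).
Proof.
move=> [fS fN]; split; first exact: act_smooth.
by move=> I IN; rewrite -iter_act_rcons fN// size_rcons; case: N IN {fN}.
Qed.

(** Induction on the word, peeling off the letter that acts first: by the Leibniz rule it lowers the
    order of only one factor, and by at most one. *)
Lemma flatM N L f g : flat N f -> flat L g -> flat (N + L) (fun p => f p * g p).
Proof.
move=> fN gL; split; first exact: smooth_onM oW fN.1 gL.1.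
move=> I; elim/last_ind: I N L f g fN gL => [|I i IH] N L f g fN gL.
  move=> /=; case: N fN => [|N] [_ fN] sI; last by rewrite [f a](fN [::])// mul0r.
  by rewrite [g a](gL.2 [::])// mulr0.
rewrite size_rcons iter_act_rcons => sI.
have fS := fN.1; have gS := gL.1.
rewrite (iter_act_eq I (act_smooth i (smooth_onM oW fS gS)) (fun p => actM i fS gS) Wa).
rewrite iter_actD//; last 2 first.
- exact: smooth_onM oW (act_smooth i fS) gS.
- exact: smooth_onM oW fS (act_smooth i gS).
(* If an order is 0, its predecessor is again 0; the length bound survives because the word has lost
   a letter. *)
rewrite (IH N.-1 L)// ?(IH N L.-1)// ?addr0//; try exact: flat_act.
- by case: L {gL} sI => [|L]; rewrite ?addn0 ?addnS// => /ltnW.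
- by case: N {fN} sI => [|N]; rewrite ?add0n ?addSn// => /ltnW.
Qed.

Lemma flat0 f : smooth_on W f -> flat 0 f.
Proof. by move=> fS; split. Qed.

(** * Leading terms of derivatives of coordinate monomials *)

Variable c : chart R n M.
Hypotheses (c_atlas : atlas c) (Wc : W `<=` cdom c) (ca : c a = 0).
Hypothesis Xc : forall i j, X i a (coordinate c j) = (j == i)%:R.

Lemma flat_coordinate j : flat 1 (coordinate c j).
Proof.
split; first exact: smooth_on_coordinate.
by case=> //= _; rewrite /coordinate ca mxE.
Qed.

(** Monomials are indexed by words so that one letter can be removed at a time and exponents can be
    compared with derivations by [perm_eq]. *)
Definition word_monomial J : M -> R := fun p => \prod_(j <- J) coordinate c j p.

Lemma flat_word_monomial J : flat (size J) (word_monomial J).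
Proof.
elim: J => [|j J IH] /=.
  apply: flat0; apply: smooth_on_eq (smooth_on_cst 1 oW) => // p _.
  by rewrite /word_monomial big_nil.
apply: flat_eq (flatM (flat_coordinate j) IH) => p _.
by rewrite /word_monomial big_cons.
Qed.

Lemma word_monomial_smooth J : smooth_on W (word_monomial J).
Proof. by have [] := flat_word_monomial J. Qed.

(** The factor [count_mem i J] absorbs the case where [i] does not occur and [rem] removes
    nothing. *)
Lemma count_word_monomial i J p :
  (count_mem i J)%:R * (coordinate c i p * word_monomial (rem i J) p) =
  (count_mem i J)%:R * word_monomial J p.
Proof.
have [iJ|/count_memPn ->] := boolP (i \in J); last by rewrite !mul0r.
by rewrite [word_monomial J p]/word_monomial (perm_big _ (perm_to_rem iJ)) big_cons.
Qed.

(** At leading order [X i] acts as the partial derivative in [x_i]. Each error term replaces one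
    factor [x_j] by a function vanishing at [a], so the order stays at least the degree of the
    monomial. *)
Lemma act_word_monomial i J : exists2 g, flat (size J) g &
  forall p, W p -> act (X i) (word_monomial J) p =
    (count_mem i J)%:R * word_monomial (rem i J) p + g p.
Proof.
elim: J => [|j J [g gJ gE]].
  exists (fun=> 0); first by apply: flat0; exact: smooth_on_cst.
  move=> p Wp /=; rewrite mul0r addr0 -(act_cst i 1 Wp).
  by apply: act_eq (word_monomial_smooth _) _ Wp => q _; rewrite /word_monomial big_nil.
(* The deviation of [X i] from the coordinate derivative on [x_j]; it vanishes at [a] by linear
   adaptation. *)
pose h p := act (X i) (coordinate c j) p + - (j == i)%:R.
have cS := smooth_on_coordinate j c_atlas Wc.
have h1 : flat 1 h.
  split; first by apply: smooth_onD => //; [exact: act_smooth | exact: smooth_on_cst].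
  by case=> //= _; rewrite /h /act Xc subrr.
exists (fun p => h p * word_monomial J p + coordinate c j p * g p).
  apply: flatD; first exact: (flatM h1 (flat_word_monomial J)).
  exact: (flatM (flat_coordinate j) gJ).
move=> p Wp; rewrite (@act_eq _ _ (fun q => coordinate c j q * word_monomial J q))//;
  last by move=> q _; rewrite /word_monomial big_cons.
  rewrite actM//; last exact: word_monomial_smooth.
  have -> : act (X i) (coordinate c j) p = h p + (j == i)%:R by rewrite /h addrNK.
  rewrite gE// /= natrD [in RHS]mulrDl.
  have -> : (if j == i then J else j :: rem i J) = rem i (j :: J) by [].
  have -> : (j == i)%:R * word_monomial (rem i (j :: J)) p =
      (j == i)%:R * word_monomial J p.
    by rewrite /=; case: eqP => // _; rewrite !mul0r.
  have -> : (count_mem i J)%:R * word_monomial (rem i (j :: J)) p =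
      coordinate c j p * ((count_mem i J)%:R * word_monomial (rem i J) p).
    rewrite /=; have [->|ji] := eqVneq j i.
      by rewrite mulrCA count_word_monomial.
    by rewrite /word_monomial big_cons mulrCA.
  by ring.
exact: word_monomial_smooth.
Qed.

(** Each derivation removes one letter of [J] and contributes its multiplicity, so that [q] is a
    product of factorials when the words match; only its positivity is kept. *)
Lemma iter_act_word_monomial I J : (size I <= size J)%N ->
  exists2 q : nat, (0 < q)%N &
    iter_act X I (word_monomial J) a = (if perm_eq I J then q%:R else 0).
Proof.
elim/last_ind: I J => [|I i IH] J sIJ.
  exists 1%N => //; case: J {sIJ} => [|j J]; first by rewrite /= /word_monomial big_nil.
  have /= -> := (flat_word_monomial (j :: J)).2 [::] isT.
  by case: ifP => // /perm_size.
rewrite size_rcons in sIJ; rewrite iter_act_rcons.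
have [g gJ gE] := act_word_monomial i J.
rewrite (iter_act_eq I (act_smooth i (word_monomial_smooth J)) gE Wa).
have mS b := smooth_onM oW (smooth_on_cst b oW) (word_monomial_smooth (rem i J)).
rewrite iter_actD//; last exact: gJ.1.
(* The error [g] vanishes to order [size J], which exceeds the length of the remaining word. *)
rewrite gJ.2// addr0 iter_actZ//; last exact: word_monomial_smooth.
have [iJ|iJ] := boolP (i \in J).
  have [|q q0 ->] := IH (rem i J); first by rewrite size_rem// -ltnS (leq_trans sIJ)// leqSpred.
  exists (count_mem i J * q)%N; first by rewrite muln_gt0 q0 -has_count has_pred1 iJ.
  have -> : perm_eq (rcons I i) J = perm_eq I (rem i J).
    by rewrite perm_rcons (permPr (perm_to_rem iJ)) perm_cons.
  by case: ifP => _; rewrite ?mulr0// natrM.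
exists 1%N => //; rewrite (count_memPn iJ) mul0r; case: ifP => // /perm_mem/(_ i).
by rewrite (negbTE iJ) mem_rcons inE eqxx.
Qed.

End Words.

(** * Triangular systems, weights and frames *)

Section TriangularSystem.
Variables (F : fieldType) (T : finType) (s : T -> nat) (P : pred T).
Variable A : T -> T -> F.
Hypothesis A_diag : forall i, A i i != 0.
Hypothesis A_trig : forall i j, (s i <= s j)%N -> i != j -> A i j = 0.

(** The equations are solved by increasing level of [s]: changing the unknowns of level [N] does not
    affect the equations of lower level, and affects an equation of level [N] only through its
    diagonal entry. *)
Lemma triangular_solution (b : T -> F) :
  exists x : T -> F, forall i, P i -> b i + \sum_(j | P j) x j * A i j = 0.
Proof.
suff [x xP] : exists x : T -> F, forall i, P i -> (s i < (\max_i s i).+1)%N ->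
    b i + \sum_(j | P j) x j * A i j = 0.
  by exists x => i Pi; apply: xP => //; rewrite ltnS leq_bigmax.
elim: (\max_i s i).+1 => [|N [x xP]]; first by exists (fun=> 0).
(* The residual of equation [i], divided by the pivot; only the unknowns of level [N] receive it. *)
pose d i := - (b i + \sum_(j | P j) x j * A i j) / A i i.
exists (fun i => x i + (s i == N)%:R * d i) => i Pi.
rewrite ltnS => siN.
have -> : \sum_(j | P j) (x j + (s j == N)%:R * d j) * A i j =
    \sum_(j | P j) x j * A i j + (s i == N)%:R * d i * A i i.
  under eq_bigr => j _ do rewrite mulrDl.
  rewrite big_split/=; congr (_ + _); rewrite (bigD1 i)//= big1 ?addr0// => j /andP[Pj ji].
  case: eqP => [sjN|_]; last by rewrite !mul0r.
  by rewrite A_trig ?mulr0// ?sjN// eq_sym.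
rewrite addrA; have [siE|sin] := eqVneq (s i) N.
  by rewrite mul1r /d divfK// subrr.
by rewrite !mul0r addr0 xP// ltn_neqAle sin.
Qed.

(** Strong induction on the level: in equation [i], the unknowns of lower level vanish by induction
    and the remaining off-diagonal coefficients by triangularity. *)
Lemma triangular_injective (x : T -> F) :
  (forall i, P i -> \sum_(j | P j) x j * A i j = 0) -> forall i, P i -> x i = 0.
Proof.
move=> x0 i; have [N] := ubnP (s i); elim: N i => // N IH i; rewrite ltnS => siN Pi.
have := x0 i Pi; rewrite (bigD1 i)//= big1 ?addr0 => [/eqP|j /andP[Pj ji]].
  by rewrite mulf_eq0 (negbTE (A_diag i)) orbF => /eqP.
have [sij|sji] := leqP (s i) (s j); first by rewrite A_trig ?mulr0// eq_sym.
by rewrite IH ?mul0r// (leq_trans sji).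
Qed.

End TriangularSystem.

(** * Linear algebra of frames, and smooth dependence of inverse matrices *)

Section LinComb.
Context {R : realType} {n : nat} {M : manifold R n}.

Lemma lin_comb_mulmx d m (u : 'rV[R]_d) (Q : 'M[R]_(d, m)) (Y : 'I_m -> functional M) f :
  lin_comb (u *m Q) Y f = \sum_j u 0 j * lin_comb (row j Q) Y f.
Proof.
rewrite /lin_comb; transitivity (\sum_k \sum_j u 0 j * (Q j k * Y k f)).
  apply: eq_bigr => k _; rewrite mxE mulr_suml.
  by apply: eq_bigr => j _; rewrite mulrA.
rewrite exchange_big; apply: eq_bigr => j _ /=; rewrite mulr_sumr.
by apply: eq_bigr => k _; rewrite mxE.
Qed.

(** A relation between the rows of [Q] would be a relation between the [Y j]. This serves both to
    bound ranks and to invert changes of frame. *)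
Lemma basis_row_free p d m (Y : 'I_d -> functional M) (Z : 'I_m -> functional M)
    (Q : 'M[R]_(d, m)) :
  (forall u : 'rV[R]_d, tv_eq p (lin_comb u Y) (fun=> 0) -> u = 0) ->
  (forall j, tv_eq p (Y j) (lin_comb (row j Q) Z)) -> row_free Q.
Proof.
move=> Y_free YZ; apply: inj_row_free => u uQ; apply: Y_free => f fp.
have : lin_comb (u *m Q) Z f = 0 by rewrite uQ /lin_comb big1// => k _; rewrite mxE mul0r.
rewrite lin_comb_mulmx => <-; apply: eq_bigr => j _; by rewrite YZ.
Qed.

Lemma smooth_on_det W m (A : M -> 'M[R]_m) : open W ->
  (forall i j, smooth_on W (fun p => A p i j)) -> smooth_on W (fun p => \det (A p)).
Proof.
move=> oW AS; apply: smooth_on_sum => // s.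
apply: smooth_onM => //; first exact: smooth_on_cst.
by apply: smooth_on_prod.
Qed.

(** Cramer's formula: the entries are cofactors divided by a determinant that does not vanish. *)
Lemma smooth_on_invmx W m (A : M -> 'M[R]_m) i j : open W ->
  (forall p, W p -> A p \in unitmx) ->
  (forall i j, smooth_on W (fun p => A p i j)) ->
  smooth_on W (fun p => invmx (A p) i j).
Proof.
move=> oW Au AS.
have S : smooth_on W (fun p => (\det (A p))^-1 * (\adj (A p)) i j).
  apply: smooth_onM => //.
    apply: smooth_onV => //; last exact: smooth_on_det.
    by move=> p /Au; rewrite unitmxE unitfE.
  have : smooth_on W (fun p => (-1) ^+ (j + i) * \det (row' j (col' i (A p)))).
    apply: smooth_onM => //; first exact: smooth_on_cst.
    apply: smooth_on_det => // k l.
    by apply: smooth_on_eq (AS (lift j k) (lift i l)) => // p _; rewrite !mxE.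
  by apply: smooth_on_eq => // p _; rewrite !mxE.
by apply: smooth_on_eq S => // p Wp; rewrite /invmx Au// [RHS]mxE.
Qed.

End LinComb.

(** * Weights and the expansion of sections in an [H]-frame *)

Section Weights.
Context {R : realType} {n r : nat} (M : carnot_manifold R n r).

Lemma weight_gt0 (j : 'I_n) : (0 < weight M j)%N.
Proof.
rewrite /weight big_nat_cond; elim/big_ind: _ => [|x y x0 y0|w].
- exact: step_gt0 M.
- by rewrite leq_min x0.
- by case/andP => /andP[].
Qed.

Lemma weight_le_hrank (j : 'I_n) w : (0 < w <= r)%N -> (j < hrank M w)%N ->
  (weight M j <= w)%N.
Proof.
move=> wr jw; rewrite /weight; have : w \in index_iota 1 r.+1 by rewrite mem_index_iota.
elim: (index_iota _ _) => // k s IH; rewrite inE big_cons => /orP[/eqP <-|ws].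
  by rewrite jw geq_minl.
by case: ifP => _; rewrite ?geq_min IH ?orbT.
Qed.

Lemma weight_le_step (j : 'I_n) : (weight M j <= r)%N.
Proof.
rewrite /weight big_nat_cond; elim/big_ind: _ => // [x y x0 y0|w].
  by rewrite geq_min x0.
by case/andP => /andP[_]; rewrite ltnS.
Qed.

Lemma hbundle_le w w' (p : M) : (0 < w)%N -> (w <= w' <= r)%N ->
  hbundle w p `<=` hbundle w' p.
Proof.
move=> w0 /andP[/subnK <-]; elim: (w' - w)%N => [|k IH] kr v vH //.
apply: hbundle_incl; first by rewrite addn_gt0 w0 orbT.
by apply: IH => //; exact: ltnW.
Qed.

Lemma seq_weight_cons i I : seq_weight M (i :: I) = (weight M i + seq_weight M I)%N.
Proof. by rewrite /seq_weight big_cons. Qed.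

Lemma seq_weight_cat I J : seq_weight M (I ++ J) = (seq_weight M I + seq_weight M J)%N.
Proof. by rewrite /seq_weight big_cat. Qed.

Lemma seq_weight_subseq I J : subseq I J -> (seq_weight M I <= seq_weight M J)%N.
Proof.
elim: J I => [|j J IH] [|i I] //=; rewrite ?seq_weight_cons.
  by rewrite /seq_weight big_nil.
case: ifP => [/eqP -> /IH|_ /IH]; first by rewrite leq_add2l.
by rewrite seq_weight_cons => /leq_trans; apply; rewrite leq_addl.
Qed.

Lemma seq_weight_perm I J : perm_eq I J -> seq_weight M I = seq_weight M J.
Proof. by move=> IJ; rewrite /seq_weight (perm_big _ IJ). Qed.

Variables (U : set M) (X : 'I_n -> field_on M).
Hypothesis X_frame : H_frame U X.

(** The first [hrank M w] vectors of the frame lie in [hbundle w p] and are independent; their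
    number being the rank, they form a basis of it. *)
Lemma hbundle_frame_expansion w p v : U p -> (0 < w <= r)%N -> hbundle w p v ->
  exists2 u : 'rV[R]_n, (forall k, (w < weight M k)%N -> u 0 k = 0) &
    tv_eq p v (lin_comb u (fun k => X k p)).
Proof.
move=> Up wr vH; have [[XV XB] XH] := X_frame.
have [Xfree Xspan] := XB p Up.
have [U' [Y [oU' U'p [YV YB]]]] := hbundle_subbundle wr p.
have [Yfree Yspan] := YB p U'p.
have /choice[q qP] : forall j, exists u : 'rV[R]_n,
    tv_eq p (Y j p) (lin_comb u (fun k => X k p)).
  by move=> j; apply/Xspan; exact: (YV j).1 _ U'p.
(* The rank is at most [n] because a basis of [hbundle w p] is free and expands in the [n] frame
   vectors; this makes the embedding of indices possible. *)
have dn : (hrank M w <= n)%N.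
  have /eqP <- : row_free (\matrix_j q j).
    apply: basis_row_free Yfree _ => j f fp; rewrite rowK; exact: qP.
  exact: rank_leq_col.
pose emb := widen_ord dn.
have emb_weight i : (weight M (emb i) <= w)%N 
  by apply: weight_le_hrank wr _; exact: ltn_ord i.
have /choice[t tP] : forall i, exists u : 'rV[R]_(hrank M w),
    tv_eq p (X (emb i) p) (lin_comb u (fun j => Y j p)).
  move=> i; apply/Yspan.
  apply: (@hbundle_le (weight M (emb i)) w); first exact: weight_gt0.
    by rewrite emb_weight; case/andP: wr.
  exact: (XH (emb i)).2 _ Up.
pose T := \matrix_i t i.
have TP i : tv_eq p (X (emb i) p) (lin_comb (row i T) (fun j => Y j p)).
  by rewrite rowK.
(* Padding by zeros: coefficients on the first frame vectors become coefficients on the whole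
   frame. *)
pose extend (z : 'rV[R]_(hrank M w)) : 'rV[R]_n := \row_k \sum_(i | emb i == k) z 0 i.
have extendE z f : lin_comb (extend z) (fun k => X k p) f =
    lin_comb z (fun i => X (emb i) p) f.
  rewrite /lin_comb; transitivity (\sum_k \sum_(i | emb i == k) z 0 i * X (emb i) p f).
    apply: eq_bigr => k _; rewrite mxE mulr_suml.
    by apply: eq_bigr => i /eqP <-.
  by rewrite [RHS](partition_big emb predT).
(* [T] is square and expresses independent frame vectors in the basis [Y], so it can be inverted to
   return from [Y] to the frame. *)
have Tu : T \in unitmx.
  rewrite -row_free_unit; apply: (basis_row_free _ TP) => z z0.
  have /rowP ez0 : extend z = 0.
    by apply: Xfree => f fp; rewrite extendE z0.
  apply/rowP => i; have := ez0 (emb i); rewrite !mxE (big_pred1 i)//.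
have [y yP] := (Yspan v).1 vH.
exists (extend (y *m invmx T)).
  move=> k wk; rewrite mxE big_pred0// => i; apply/eqP => ik.
  by move: wk; rewrite -ik ltnNge emb_weight.
move=> f fp; rewrite extendE yP//.
have {1}-> : y = (y *m invmx T) *m T by rewrite mulmxKV.
by rewrite lin_comb_mulmx; apply: eq_bigr => i _; rewrite TP.
Qed.

End Weights.

(** * Reordering words *)

Section Reordering.
Context {R : realType} {n r : nat} (M : carnot_manifold R n r).
Variables (U W : set M) (X : 'I_n -> field_on M) (c : chart R n M).
Hypotheses (U_open : open U) (X_frame : H_frame U X).
Hypotheses (W_open : open W) (WU : W `<=` U).
Hypotheses (c_atlas : atlas c) (Wc : W `<=` cdom c).

Lemma frame_vector_field i : vector_field W (X i).
Proof. by apply: vector_field_subset WU _; exact: X_frame.1.1. Qed.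

Definition frame_matrix p : 'M[R]_n := \matrix_(k, m) X k p (coordinate c m).

Lemma frame_matrix_unit p : W p -> frame_matrix p \in unitmx.
Proof.
move=> Wp; have [[XV XB] _] := X_frame; have [Xfree _] := XB p (WU Wp).
rewrite -row_free_unit; apply: (basis_row_free Xfree) => k f fp.
rewrite (tangent_coord ((XV k).1 _ (WU Wp)) c_atlas (Wc Wp) fp).
by apply: eq_bigr => m _; rewrite !mxE.
Qed.

(** Two descriptions of the coefficients are combined: Cramer's formula in the chart gives
    smoothness, and the pointwise expansion of a vector of [hbundle] gives the vanishing for heavy
    [k]. *)
Lemma bracket_expansion i j : (weight M i + weight M j <= r)%N ->
  exists2 L : 'I_n -> M -> R, (forall k, smooth_on W (L k)) &
    (forall k p, (weight M i + weight M j < weight M k)%N -> W p -> L k p = 0) /\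
    (forall f p, smooth_on W f -> W p ->
      act (X i) (act (X j) f) p =
        act (X j) (act (X i) f) p + \sum_k L k p * act (X k) f p).
Proof.
move=> ijr; have [[XV XB] XH] := X_frame.
have [ZV ZH] := hbundle_bracket (weight_gt0 M i) (weight_gt0 M j) ijr U_open (XH i) (XH j).
pose Z := lie_bracket (X i) (X j).
have ZVW : vector_field W Z by exact: vector_field_subset WU ZV.
pose L k p := \sum_m Z p (coordinate c m) * invmx (frame_matrix p) m k.
have cS m : smooth_on W (coordinate c m) by exact: smooth_on_coordinate.
have LS k : smooth_on W (L k).
  apply: smooth_on_sum => // m; apply: smooth_onM => //.
    exact: ZVW.2.
  apply: smooth_on_invmx => // [|k' m']; first exact: frame_matrix_unit.
  have S : smooth_on W (act (X k') (coordinate c m')).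
    by apply: (frame_vector_field k').2.
  by apply: smooth_on_eq S => // p _; rewrite mxE.
(* Testing on the coordinate functions shows that every pointwise expansion has the coefficients
   [L], since the frame matrix is invertible. *)
have Lspec p u : W p -> tv_eq p (Z p) (lin_comb u (fun k => X k p)) ->
    forall k, u 0 k = L k p.
  move=> Wp Zu k; rewrite /L.
  have -> : u = (\row_m Z p (coordinate c m)) *m invmx (frame_matrix p).
    rewrite -[LHS](mulmxK (frame_matrix_unit Wp)); congr (_ *m _).
    apply/rowP => m; rewrite !mxE Zu; last exact: smooth_on_at W_open Wp (cS m).
    by apply: eq_bigr => l _; rewrite mxE.
  by rewrite mxE; apply: eq_bigr => m _; rewrite mxE.
have wr : (0 < weight M i + weight M j <= r)%N by rewrite addn_gt0 weight_gt0.
have Zexp p : W p -> exists2 u : 'rV[R]_n,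
    (forall k, (weight M i + weight M j < weight M k)%N -> u 0 k = 0) &
    tv_eq p (Z p) (lin_comb u (fun k => X k p)).
  by move=> Wp; apply: (hbundle_frame_expansion X_frame (WU Wp) wr); exact: ZH (WU Wp).
exists L => //; split=> [k p wk Wp|f p fS Wp].
  by have [u u0 Zu] := Zexp p Wp; rewrite -(Lspec p u)// u0.
have [u _ Zu] := Zexp p Wp.
have -> : \sum_k L k p * act (X k) f p = Z p f.
  rewrite Zu; last exact: smooth_on_at W_open Wp fS.
  by apply: eq_bigr => k _; rewrite (Lspec p u).
by rewrite /Z /lie_bracket addrC subrK.
Qed.

Variable a : M.
Hypothesis Wa : W a.

Let XW := frame_vector_field.

(** By the Leibniz rule every term contains a derivative of [h] along a subword of [I]. *)
Lemma iter_act_mul0 I (L h : M -> R) : smooth_on W L -> smooth_on W h ->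
  (forall J, subseq J I -> iter_act X J h a = 0) ->
  iter_act X I (fun p => L p * h p) a = 0.
Proof.
elim/last_ind: I L h => [|I i IH] L h LS hS h0.
  by rewrite /= [h a](h0 [::])// mulr0.
rewrite iter_act_rcons.
have XS f := @act_smooth _ _ _ _ _ _ W_open XW i f.
rewrite (iter_act_eq W_open XW I (XS _ (smooth_onM W_open LS hS))
  (fun p => actM W_open XW i LS hS) Wa).
rewrite (iter_actD W_open XW)//; last 2 first.
- exact: smooth_onM W_open (XS _ LS) hS.
- exact: smooth_onM W_open LS (XS _ hS).
rewrite !IH ?addr0//; try exact: XS.
  by move=> J JI; rewrite -iter_act_rcons; apply: h0; rewrite -!cats1 cat_subseq.
by move=> J JI; apply: h0; apply: subseq_trans JI _; exact: subseq_rcons.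
Qed.

Variables (f : M -> R) (N : nat).
Hypotheses (fS : smooth_on W f) (Nr : (N <= r)%N).

(** The induction hypothesis on word length under which words may be reordered. *)
Definition vanish_below m :=
  forall I, (size I < m)%N -> (seq_weight M I < N)%N -> iter_act X I f a = 0.

(** The two sides differ by a bracket term. It replaces [i] and [j] by one letter of weight at most
    the sum, and the smooth coefficient can only shorten the prefix; all resulting words are shorter
    and no heavier, hence vanish by [vm]. The bound by [r] makes the bracket condition available. *)
Lemma iter_act_swap m I i j J : vanish_below m ->
  (size (I ++ i :: j :: J) <= m)%N -> (seq_weight M (I ++ i :: j :: J) < N)%N ->
  iter_act X (I ++ i :: j :: J) f a = iter_act X (I ++ j :: i :: J) f a.
Proof.
rewrite size_cat seq_weight_cat !seq_weight_cons /= => vm sm wN.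
have ijr : (weight M i + weight M j <= r)%N.
  apply: leq_trans Nr; apply: leq_trans (ltnW wN).
  by rewrite (addnA (weight M i)) addnCA leq_addr.
have [L LS [L0 LE]] := bracket_expansion ijr.
have gS := iter_act_smooth W_open XW J fS.
set g := iter_act X J f in gS.
have XS k h := @act_smooth _ _ _ _ _ _ W_open XW k h.
rewrite !iter_act_cat /= -/g.
rewrite (iter_act_eq W_open XW I (XS i _ (XS j _ gS)) (fun p => LE g p gS) Wa).
have S k : smooth_on W (fun p => L k p * act (X k) g p).
  by apply: smooth_onM => //; exact: XS.
rewrite (iter_actD W_open XW)//; last 2 first.
- exact: (XS _ _ (XS _ _ gS)).
- by apply: smooth_on_sum.
rewrite (iter_act_sum W_open XW)// big1 ?addr0// => k _.
have [kw|wk] := leqP (weight M k) (weight M i + weight M j).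
  apply: iter_act_mul0 => //; first exact: XS.
  move=> K KI; rewrite -[act _ _]/(iter_act X (k :: J) f) -iter_act_cat; apply: vm.
    rewrite size_cat /=; apply: leq_trans sm.
    by rewrite !addnS !ltnS leq_add2r size_subseq.
  rewrite seq_weight_cat seq_weight_cons; apply: leq_ltn_trans wN.
  by rewrite leq_add ?seq_weight_subseq// addnA leq_add2r.
(* For heavier [k] the coefficient is zero on all of [W], so its derivatives vanish too. *)
have -> : iter_act X I (fun p => L k p * act (X k) g p) a =
    iter_act X I (fun p => 0 * act (X k) g p) a.
  by apply: (iter_act_eq W_open XW) => // p Wp; rewrite L0.
by rewrite (iter_actZ W_open XW)// ?mul0r//; exact: XS.
Qed.

Lemma iter_act_move m I i J K : vanish_below m ->
  (size (I ++ i :: J ++ K) <= m)%N -> (seq_weight M (I ++ i :: J ++ K) < N)%N ->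
  iter_act X (I ++ i :: J ++ K) f a = iter_act X (I ++ J ++ i :: K) f a.
Proof.
move=> vm; elim: J I => // j J IH I sm wN.
have pm : perm_eq (rcons I j ++ i :: J ++ K) (I ++ i :: (j :: J) ++ K).
  by rewrite cat_rcons perm_cat2l (perm_catCA [:: j] [:: i]).
rewrite /= (iter_act_swap vm)// -cat_rcons IH ?cat_rcons//.
  by rewrite -cat_rcons (perm_size pm).
by rewrite -cat_rcons (seq_weight_perm M pm).
Qed.

(** [P] is the part already in its final position: the first letter of [I] is brought to the front
    of [J], then joins the prefix. *)
Lemma iter_act_perm m P I J : vanish_below m -> perm_eq I J ->
  (size (P ++ I) <= m)%N -> (seq_weight M (P ++ I) < N)%N ->
  iter_act X (P ++ I) f a = iter_act X (P ++ J) f a.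
Proof.
move=> vm; elim: I P J => [|i I IH] P J IJ sm wN.
  by move: IJ; rewrite perm_sym => /perm_nilP ->.
have iJ : i \in J by rewrite -(perm_mem IJ) mem_head.
case/splitPr: iJ IJ => J1 J2.
rewrite perm_sym perm_catC /= perm_cons perm_catC perm_sym => IJ.
have pm : perm_eq (P ++ i :: I) (P ++ i :: J1 ++ J2) by rewrite perm_cat2l perm_cons.
rewrite -(@iter_act_move m P i J1 J2) -?(perm_size pm) -?(seq_weight_perm M pm)//.
rewrite -[P ++ i :: I]cat_rcons -[P ++ i :: _]cat_rcons.
by apply: IH; rewrite ?cat_rcons.
Qed.

(** Reduces the weighted order to one ordering of each multiset of letters, by induction on length:
    shorter words vanish already, so a word may be replaced by its chosen rearrangement. *)
Lemma order_ge_up_to_perm :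
  (forall I, (seq_weight M I < N)%N -> exists2 J, perm_eq I J & iter_act X J f a = 0) ->
  order_ge X a f N.
Proof.
move=> fJ; suff vm m : vanish_below m by move=> I; exact: (vm (size I).+1).
elim: m => // m vm I; rewrite ltnS => Im wN.
have [J IJ J0] := fJ I wN.
by rewrite -[I]cat0s (iter_act_perm vm IJ).
Qed.

End Reordering.

(** * Graded polynomial maps and their inverses *)

Section MultiIndexWords.
Context {R : realType} {n r : nat} (M : carnot_manifold R n r).
Implicit Types alpha beta : @multi_index n r.

Definition mi_word alpha : seq 'I_n := flatten [seq nseq (alpha i) i | i <- enum 'I_n].

Lemma count_mi_word i alpha : count_mem i (mi_word alpha) = alpha i.
Proof.
rewrite /mi_word count_flatten -map_comp sumnE big_map big_enum /= (bigD1 i)//=.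
rewrite count_nseq /= eqxx mul1n big1 ?addn0// => j ji.
by rewrite count_nseq /= (negbTE ji).
Qed.

Lemma size_mi_word alpha : size (mi_word alpha) = mi_length alpha.
Proof.
rewrite /mi_word size_flatten /shape -map_comp sumnE big_map big_enum /=.
by apply: eq_bigr => i _; rewrite size_nseq.
Qed.

Lemma seq_weight_mi_word alpha : seq_weight M (mi_word alpha) = mi_weight M alpha.
Proof.
rewrite /seq_weight big_flatten big_map big_enum /=.
by apply: eq_bigr => i _; rewrite big_nseq iter_addn_0.
Qed.

Lemma word_monomial_mi_word (c : chart R n M) alpha p :
  word_monomial c (mi_word alpha) p = monomial (c p) alpha.
Proof.
rewrite /word_monomial big_flatten big_map big_enum /=.
by apply: eq_bigr => i _; rewrite big_nseq iter_mulr_1.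
Qed.

Lemma mi_word_inj alpha beta : perm_eq (mi_word alpha) (mi_word beta) -> alpha = beta.
Proof.
move=> /permP ab; apply/ffunP => i; apply: val_inj => /=.
by rewrite -!count_mi_word ab.
Qed.

Lemma size_le_seq_weight I : (size I <= seq_weight M I)%N.
Proof.
elim: I => //= i I IH; rewrite seq_weight_cons -add1n leq_add//.
exact: weight_gt0.
Qed.

(** Every letter has weight at least 1, so multiplicities are bounded by the weight of the word and
    fit in ['I_r]. *)
Lemma word_multi_index I : (seq_weight M I < r)%N ->
  exists alpha, perm_eq I (mi_word alpha).
Proof.
move=> Ir.
have cr i : (count_mem i I < r)%N.
  by apply: leq_ltn_trans Ir; apply: leq_trans (size_le_seq_weight I); exact: count_size.
exists [ffun i => Ordinal (cr i)]; apply/allP => i _ /=.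
by rewrite count_mi_word ffunE.
Qed.

End MultiIndexWords.

Section GradedMap.
Context {R : realType} {n r : nat} (M : carnot_manifold R n r).
Variable coef : 'I_n -> @multi_index n r -> R.
Implicit Types x y z : 'rV[R]_n.

Definition corrective k (alpha : @multi_index n r) :=
  ((mi_weight M alpha < weight M k) && (2 <= mi_length alpha))%N.

Definition correction x : 'rV[R]_n :=
  \row_k \sum_(alpha | corrective k alpha) coef k alpha * monomial x alpha.

Definition graded_map x := x + correction x.

(* The k-th component of the correction involves only the x_i with w_i < w_k, so
   that inverting [graded_map] by fixed point iteration stops after r steps. *)
Definition graded_inv y := iter r (fun z => y - correction z) y.

(** A variable [x_i] occurring in a corrective monomial contributes at least its weight to a total
    below that of [k]. *)
Lemma correction_lower x y k :
  (forall i, (weight M i < weight M k)%N -> x 0 i = y 0 i) ->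
  correction x 0 k = correction y 0 k.
Proof.
move=> xy; rewrite !mxE; apply: eq_bigr => alpha /andP[ak _]; congr (_ * _).
apply: eq_bigr => i _; have [->|ai] := posnP (alpha i); first by rewrite !expr0.
rewrite xy//; apply: leq_ltn_trans ak; rewrite /mi_weight (bigD1 i)//=.
by apply: leq_trans (leq_addr _ _); rewrite leq_pmulr.
Qed.

Lemma graded_inv_fixpoint y : y - correction (graded_inv y) = graded_inv y.
Proof.
rewrite /graded_inv; set T := fun z => y - correction z.
(* After [m] iterations the components of weight at most [m] are stationary, and no weight exceeds
   [r]. At [m = 0] there is nothing to check, as weights are positive. *)
suff E m k : (weight M k <= m)%N -> T (iter m T y) 0 k = iter m T y 0 k.
  by apply/rowP => k; exact: E (weight_le_step M k).
elim: m k => [|m IH] k km; first by move: (weight_gt0 M k); rewrite ltnNge km.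
have TE z : T z 0 k = y 0 k - correction z 0 k by rewrite mxE [X in _ + X]mxE.
rewrite iterS !TE; congr (_ - _); apply: correction_lower => i ik.
by apply: IH; rewrite -ltnS (leq_trans ik).
Qed.

Lemma graded_invK : cancel graded_inv graded_map.
Proof. by move=> y; rewrite /graded_map -{1}graded_inv_fixpoint subrK. Qed.

(** Induction on the weight of the component: once the lighter components agree, so do the
    corrections. With [graded_invK] this makes the inverse two-sided. *)
Lemma graded_map_inj : injective graded_map.
Proof.
move=> x y xy; apply/rowP => k.
have [m] := ubnP (weight M k); elim: m k => // m IH k; rewrite ltnS => km.
have := congr1 (fun z => z 0 k) xy.
rewrite /graded_map ![(_ + correction _) 0 k]mxE (@correction_lower x y) => [/addIr//|i ik].
by apply: IH; exact: leq_trans ik km.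
Qed.

Lemma graded_mapK : cancel graded_map graded_inv.
Proof. by move=> x; apply: graded_map_inj; rewrite graded_invK. Qed.

Lemma monomial_smooth (alpha : @multi_index n r) :
  is_Cinfty setT (fun x : 'rV[R]_n => monomial x alpha).
Proof.
move=> m; apply: is_Ck_prod => [|i]; first exact: openT.
have S : is_Ck m setT (fun x : 'rV[R]_n => \prod_(j < alpha i) x 0 i).
  by apply: is_Ck_prod => [|_]; [exact: openT | apply: is_Ck_coord; exact: openT].
by apply: is_Ck_eq S => [|x _]; [exact: openT | rewrite prodr_const card_ord].
Qed.

Lemma correction_smooth k : is_Cinfty setT (fun x => correction x 0 k).
Proof.
move=> m; have S : is_Ck m setT (fun x : 'rV[R]_n =>
    \sum_(alpha | corrective k alpha) coef k alpha * monomial x alpha).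
  apply: is_Ck_sum => [|alpha]; first exact: openT.
  by apply: is_CkM; [exact: openT | apply: is_Ck_cst; exact: openT | exact: monomial_smooth].
by apply: is_Ck_eq S => [|x _]; [exact: openT | rewrite mxE].
Qed.

Lemma graded_map_smooth k : is_Cinfty setT (fun x => graded_map x 0 k).
Proof.
move=> m; have S := is_CkD openT (is_Ck_coord m k openT) (correction_smooth k m).
by apply: is_Ck_eq S => [|x _]; [exact: openT | rewrite [RHS]mxE].
Qed.

Lemma graded_inv_smooth k : is_Cinfty setT (fun y => graded_inv y 0 k).
Proof.
move=> m; rewrite /graded_inv; elim: r k => [|s IH] k.
  by apply: is_Ck_coord; exact: openT.
have C : is_Ck m setT ((fun x => correction x 0 k) \o
    (fun y => iter s (fun z => y - correction z) y)).
  by apply: (is_Ck_comp openT openT _ (correction_smooth k m)).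
have S := is_CkD openT (is_Ck_coord m k openT)
  (is_CkM openT (is_Ck_cst m (-1) openT) C).
apply: is_Ck_eq S => [|x _]; first exact: openT.
by rewrite iterS mulN1r /= [RHS]mxE [X in _ = _ + X]mxE.
Qed.

End GradedMap.

(** * Privileged coordinates *)

Section PrivilegedCoordinates.
Context {R : realType} {n r : nat} (M : carnot_manifold R n r).
Variables (a : M) (U : set M) (X : 'I_n -> field_on M) (c : chart R n M).
Hypotheses (U_open : open U) (Ua : U a) (X_frame : H_frame U X).
Hypothesis c_adapted : linearly_adapted X a c.

Let c_atlas : atlas c. Proof. by case: c_adapted => -[]. Qed.
Let c_dom : cdom c a. Proof. by case: c_adapted => -[]. Qed.
Let c_center : c a = 0. Proof. by case: c_adapted => -[]. Qed.

Let W := U `&` cdom c.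
Let oW : open W. Proof. by apply: openI => //; exact: cdom_open. Qed.
Let Wa : W a. Proof. by []. Qed.
Let WU : W `<=` U. Proof. by move=> p []. Qed.
Let Wc : W `<=` cdom c. Proof. by move=> p []. Qed.
Let XW i : vector_field W (X i).
Proof. exact: frame_vector_field X_frame WU i. Qed.

Lemma adapted_coordinate i j : X i a (coordinate c j) = (j == i)%:R.
Proof.
case: c_adapted => _ /(_ i) ->; first exact: coord_vector_coordinate.
exact: smooth_at_coordinate.
Qed.

Let mon alpha := word_monomial c (@mi_word n r alpha).

Lemma mon_flat alpha : flat X W a (mi_length alpha) (mon alpha).
Proof.
rewrite -size_mi_word; apply: (flat_word_monomial oW XW Wa c_atlas Wc c_center).
Qed.

(** Rows are derivations along ordered words, columns are monomials; the matrix does not depend on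
    the component [k]. *)
Definition word_matrix (alpha beta : @multi_index n r) : R :=
  iter_act X (mi_word alpha) (mon beta) a.

Lemma word_matrix_diag alpha : word_matrix alpha alpha != 0.
Proof.
have [|q q0] := iter_act_word_monomial oW XW Wa c_atlas Wc c_center adapted_coordinate
  (I := mi_word alpha) (J := mi_word alpha) => //.
by rewrite perm_refl /word_matrix => ->; rewrite pnatr_eq0 -lt0n.
Qed.

Lemma word_matrix_trig alpha beta : (mi_length alpha <= mi_length beta)%N ->
  alpha != beta -> word_matrix alpha beta = 0.
Proof.
rewrite -!size_mi_word => sab ab.
have [q _] := iter_act_word_monomial oW XW Wa c_atlas Wc c_center adapted_coordinate sab.
rewrite /word_matrix => ->; case: ifP => // /mi_word_inj E.
by rewrite E eqxx in ab.
Qed.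

Section Component.
Variable coef : 'I_n -> @multi_index n r -> R.

Definition component k : M -> R := fun p => graded_map M coef (c p) 0 k.

Lemma componentE k p : component k p =
  coordinate c k p + \sum_(alpha | corrective M k alpha) coef k alpha * mon alpha p.
Proof.
rewrite /component /graded_map !mxE; congr (_ + _); apply: eq_bigr => alpha _.
by rewrite /mon word_monomial_mi_word.
Qed.

Let monS k alpha : smooth_on W (fun p => coef k alpha * mon alpha p).
Proof. exact: smooth_onM oW (smooth_on_cst _ oW) (mon_flat alpha).1. Qed.

Lemma component_smooth k : smooth_on W (component k).
Proof.
have S := smooth_onD oW (smooth_on_coordinate k c_atlas Wc)
  (smooth_on_sum (index_enum _) (corrective M k) oW (monS k)).
by apply: (smooth_on_eq oW _ S) => p _; rewrite componentE.
Qed.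

Lemma iter_act_component I k : iter_act X I (component k) a =
  iter_act X I (coordinate c k) a +
  \sum_(alpha | corrective M k alpha) coef k alpha * iter_act X I (mon alpha) a.
Proof.
have S := smooth_on_sum (index_enum _) (corrective M k) oW (monS k).
rewrite (iter_act_eq oW XW I (component_smooth k) (fun p _ => componentE k p) Wa).
rewrite (iter_actD oW XW)//; last exact: smooth_on_coordinate.
rewrite (iter_act_sum oW XW)//; congr (_ + _); apply: eq_bigr => alpha _.
by rewrite (iter_actZ oW XW)//; exact: (mon_flat alpha).1.
Qed.

(** Corrective monomials vanish to order 2 at [a], so the change of coordinates preserves the centre
    and the linear adaptation. *)
Lemma iter_act_component_short I k : (size I <= 1)%N ->
  iter_act X I (component k) a = iter_act X I (coordinate c k) a.
Proof.
move=> sI; rewrite iter_act_component big1 ?addr0// => alpha /andP[_ la].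
by rewrite (mon_flat alpha).2 ?mulr0//; exact: leq_ltn_trans sI la.
Qed.

Lemma act_component i k : X i a (component k) = (k == i)%:R.
Proof.
by rewrite -[LHS]/(iter_act X [:: i] (component k) a) iter_act_component_short//
  -adapted_coordinate.
Qed.

(** By [iter_act_component], this is the vanishing at [a] of the derivatives of each component along
    its corrective ordered words, written as a linear system. *)
Definition solves_word_system := forall k alpha, corrective M k alpha ->
  iter_act X (mi_word alpha) (coordinate c k) a +
  \sum_(beta | corrective M k beta) coef k beta * word_matrix alpha beta = 0.

(** Words of length at most 1 see only the coordinate [x_k], and a single letter lighter than [k]
    differs from [k]. A longer word of weight below that of [k] is a rearrangement of a corrective
    ordered word, where the system applies. *)
Lemma component_order_ge k : solves_word_system ->
  order_ge X a (component k) (weight M k).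
Proof.
move=> sol; apply: (order_ge_up_to_perm U_open X_frame oW WU c_atlas Wc Wa
  (component_smooth k) (weight_le_step M k)) => I Ik.
have [sI|lI] := leqP (size I) 1.
  exists I => //; rewrite iter_act_component_short//.
  case: I Ik sI => [|i [|//]]; first by rewrite /= /coordinate c_center mxE.
  rewrite seq_weight_cons /= => Ik _; rewrite /act adapted_coordinate.
  case: eqP => // E; move: Ik; rewrite E ltnNge leq_addr//.
have [alpha Ia] := word_multi_index (leq_trans Ik (weight_le_step M k)).
exists (mi_word alpha) => //; rewrite iter_act_component; apply: sol.
by rewrite /corrective -seq_weight_mi_word -size_mi_word -(perm_size Ia)
  -(seq_weight_perm M Ia) Ik.
Qed.

(** Gives uniqueness: the order condition on the [k]-th privileged coordinate contains the equations
    of the system for [k]. *)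
Lemma privileged_solves (psi : 'rV[R]_n -> 'rV[R]_n) c' :
  (forall x, psi x = graded_map M coef x) ->
  changes_coords psi c c' -> privileged X a c' -> solves_word_system.
Proof.
move=> psiE [c'c c'E] [[[c'a c'd _] _] c'o] k alpha /[dup] Bk /andP[ak _].
have [ok _] := c'o k.
rewrite -iter_act_component -(ok (mi_word alpha)) ?seq_weight_mi_word//.
(* The coordinates of [c'] agree with the components only on [cdom c'], so derivatives are compared
   on this smaller neighbourhood of [a]. *)
pose W' := U `&` cdom c'.
have oW' : open W' by apply: openI => //; exact: cdom_open.
have W'U : W' `<=` U by move=> p [].
have XW' := frame_vector_field X_frame W'U.
apply/esym; apply: (iter_act_eq oW' XW') => //.
  by apply: (smooth_on_coordinate (c := c')) => // p [].
by move=> p [_ pc]; rewrite c'E// psiE.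
Qed.

Definition graded_chart : chart R n M := chart_change c
  (graded_mapK M coef) (graded_invK M coef) (graded_map_smooth M coef)
  (graded_inv_smooth M coef).

Lemma graded_chart_privileged : solves_word_system -> privileged X a graded_chart.
Proof.
move=> sol.
have ga : atlas graded_chart by exact: chart_change_atlas.
have center : graded_chart a = 0.
  apply/rowP => k; rewrite [RHS]mxE -[LHS]/(iter_act X [::] (component k) a).
  by rewrite iter_act_component_short//= /coordinate c_center mxE.
split; first split.
- by split.
- move=> j; apply: (@tangent_eq_coordinates _ _ _ graded_chart) => //.
  + exact: (XW j).1.
  + exact: coord_vector_tangent.
  + by move=> k; rewrite coord_vector_coordinate//; exact: act_component.
move=> k; split; first exact: component_order_ge.
(* The order is attained on the one-letter word [k], along which the component has derivative 1 at
   [a]. *)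
exists [:: k]; split; first by rewrite /seq_weight big_seq1.
by rewrite -[iter_act _ _ _ _]/(X k a (component k)) act_component eqxx; apply/eqP/oner_neq0.
Qed.

End Component.

(** The components decouple: each [k] gives its own system, triangular with respect to
    [mi_length]. *)
Lemma solution_exists : exists coef, solves_word_system coef.
Proof.
have /choice[coef coefP] := fun k => triangular_solution (corrective M k)
  word_matrix_diag word_matrix_trig
  (fun alpha => iter_act X (mi_word alpha) (coordinate c k) a).
by exists coef => k; exact: coefP.
Qed.

(** The difference of two solutions solves the homogeneous system. Equality is asserted for the
    maps, which read the coefficients exactly at the corrective multi-indices. *)
Lemma solution_unique coef coef' : solves_word_system coef -> solves_word_system coef' ->
  graded_map M coef = graded_map M coef'.
Proof.
move=> s s'; apply/funext => x; congr (_ + _); apply/rowP => k; rewrite !mxE.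
apply: eq_bigr => alpha Ba; congr (_ * _); apply/eqP; rewrite -subr_eq0; apply/eqP.
apply: (triangular_injective (x := fun alpha => coef k alpha - coef' k alpha)
  word_matrix_diag word_matrix_trig _ Ba) => beta Bb.
have /addrI E := etrans (s k beta Bb) (esym (s' k beta Bb)).
transitivity (\sum_(j | corrective M k j) coef k j * word_matrix beta j -
    \sum_(j | corrective M k j) coef' k j * word_matrix beta j).
  by rewrite -sumrB; apply: eq_bigr => j _; rewrite mulrBl.
by rewrite E subrr.
Qed.

End PrivilegedCoordinates.

Theorem proposition3p17 (R : realType) (n r : nat) (M : carnot_manifold R n r)
    (a : M) (U : set M) (X : 'I_n -> field_on M) (c : chart R n M)
    (U_open : open U) (Ua : U a) (X_frame : H_frame U X)
    (c_adapted : linearly_adapted X a c) :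
  exists! psi : 'rV[R]_n -> 'rV[R]_n,
    (exists c' : chart R n M, changes_coords psi c c' /\ privileged X a c') /\
    (exists coef : 'I_n -> multi_index -> R,
       forall (x : 'rV[R]_n) (k : 'I_n),
         psi x 0 k = x 0 k +
           \sum_(alpha : multi_index |
                   ((mi_weight M alpha < weight M k) && (2 <= mi_length alpha))%N)
             coef k alpha * monomial x alpha).
Proof.
have [coef sol] := solution_exists U_open Ua X_frame c_adapted.
exists (graded_map M coef); split; first split.
- exists (graded_chart c coef); split.
    by split.
  exact: (graded_chart_privileged U_open Ua X_frame c_adapted sol).
- by exists coef => x k; rewrite !mxE.
(* Any competitor is itself a graded map by its form, so privilegedness makes its coefficients solve
   the same system. *)
move=> psi [[c' [psi_c' c'_priv]] [coef' psiE]].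
have E x : psi x = graded_map M coef' x.
  by apply/rowP => k; rewrite psiE !mxE.
rewrite (_ : psi = graded_map M coef'); last exact/funext.
apply: (solution_unique U_open Ua X_frame c_adapted sol).
exact: (privileged_solves U_open Ua X_frame c_adapted E psi_c' c'_priv).
Qed.
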